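(* Let $(M,g)$ be an $n$-dimensional Riemannian manifold and let $T^p_q(M)$ be its $(p,q)$-tensor bundle with the rescaled Sasaki type metric ${}^Sg_f$, whose Levi-Civita connection is denoted $\widehat\nabla$. The horizontal lift of a geodesic on $M$ is always a geodesic on $T^p_q(M)$ with respect to the Levi-Civita connection $\widehat\nabla$ of ${}^Sg_f$ if and only if $f=C$ (const.).
   Context: All objects are of class $C^\infty$; Einstein summation. $f>0$ is a smooth function on $M$. $\Gamma_{ij}^h$ are the coefficients of the Levi-Civita connection $\nabla$ of $g$. $T^p_q(M)$ is the bundle of tensors of type $(p,q)$ over $M$ ($p$ contravariant, $q$ covariant indices), with induced local coordinates $(x^j,t^{i_1\dots i_p}_{j_1\dots j_q})$. The vertical lift of a $(p,q)$-tensor field $A$ is ${}^VA=A^{i_1\dots i_p}_{j_1\dots j_q}\,\partial/\partial t^{i_1\dots i_p}_{j_1\dots j_q}$; the horizontal lift of a vector field $X$ is $${}^HX=X^j\frac{\partial}{\partial x^j}+X^s\Big(\sum_{\mu=1}^q\Gamma_{sj_\mu}^mt^{i_1\dots i_p}_{j_1\dots m\dots j_q}-\sum_{\lambda=1}^p\Gamma_{sm}^{i_\lambda}t^{i_1\dots m\dots i_p}_{j_1\dots j_q}\Big)\frac{\partial}{\partial t^{i_1\dots i_p}_{j_1\dots j_q}}.$$ The rescaled Sasaki type metric ${}^Sg_f$ on $T^p_q(M)$ is defined by ${}^Sg_f({}^VA,{}^VB)=g_{i_1c_1}\cdots g_{i_pc_p}g^{j_1l_1}\cdots g^{j_ql_q}A^{i_1\dots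 i_p}_{j_1\dots j_q}B^{c_1\dots c_p}_{l_1\dots l_q}$, ${}^Sg_f({}^VA,{}^HY)=0$, ${}^Sg_f({}^HX,{}^HY)=f\,g(X,Y)$ (functions on $M$ being pulled back to $T^p_q(M)$). Given a curve $\gamma$ on $M$, locally $x^h=x^h(t)$, and a $(p,q)$-tensor field $S^{k_1\dots k_p}_{h_1\dots h_q}(t)$ along $\gamma$, let ${}^H\gamma$ be the curve in $T^p_q(M)$ given by $x^h=x^h(t)$, $t^{k_1\dots k_p}_{h_1\dots h_q}=S^{k_1\dots k_p}_{h_1\dots h_q}(t)$. If $S$ is parallel along $\gamma$ with respect to $\nabla$ (its covariant derivative along $\gamma$ vanishes at all points), then ${}^H\gamma$ is called a horizontal lift of $\gamma$. Geodesics are curves satisfying the geodesic differential equation of the connection in the parameter $t$, and the lift carries the same parameter as $\gamma$.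
   Formalization: The manifold M is assumed connected; on a disconnected M (e.g. two copies of R^n with f=1 and f=2) every horizontal lift of a geodesic is a geodesic although f is not constant. *)

(* Defs.v *)
From mathcomp Require Import all_boot all_order all_algebra.
From mathcomp Require Import all_classical all_reals all_analysis.
From mathcomp Require Import ring.
Set Implicit Arguments.
Unset Strict Implicit.
Unset Printing Implicit Defensive.
Import Order.TTheory GRing.Theory Num.Theory.
Import numFieldNormedType.Exports.
Local Open Scope classical_set_scope.
Local Open Scope ring_scope.

Definition partial (R : realType) (d : nat) (F : 'rV[R]_d -> R) (a : 'I_d)
    (y : 'rV[R]_d) : R :=
  'D_('e_a) F y.

Fixpoint Ck_on (R : realType) (d k : nat) (U : set 'rV[R]_d)
    (F : 'rV[R]_d -> R) : Prop :=
  (forall y, U y -> {for y, continuous F}) /\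
  if k is k'.+1 then
    forall a : 'I_d, (forall y, U y -> derivable F y 'e_a) /\
                     Ck_on k' U (partial F a)
  else True.

(* Meant for open U: the derivatives are those of the ambient space. *)
Definition smooth_on (R : realType) (d : nat) (U : set 'rV[R]_d)
    (F : 'rV[R]_d -> R) : Prop :=
  forall k, Ck_on k U F.

(* A set with a family of coordinate systems of dimension d. This is all that
   is needed to express Levi-Civita connections and geodesics, so that M and
   its tensor bundles share the definitions below. chart_coord i is relevant on
   chart_dom i only. *)
Record coord_space (R : realType) (d : nat) := CoordSpace {
  cs_point : Type;
  chart : Type;
  chart_dom : chart -> set cs_point;
  chart_coord : chart -> cs_point -> 'rV[R]_d
}.
Arguments chart_dom {R d} c _.
Arguments chart_coord {R d} c _ _.

(* mpar i inverts mcoord i on the chart domain; it is arbitrary outside of the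
   image of the chart. Manifolds are connected, so that functions with zero
   differential are constant. *)
Record manifold (R : realType) (n : nat) := Manifold {
  mpoint :> topologicalType;
  mchart : Type;
  mdom : mchart -> set mpoint;
  mcoord : mchart -> mpoint -> 'rV[R]_n;
  mpar : mchart -> 'rV[R]_n -> mpoint;
  m_hausdorff : hausdorff_space mpoint;
  m_second_countable : @second_countable mpoint;
  m_connected : connected [set: mpoint];
  m_cover : forall x, exists i, mdom i x;
  m_dom_open : forall i, open (mdom i);
  m_image_open : forall i, open (mcoord i @` mdom i);
  m_coordK : forall i x, mdom i x -> mpar i (mcoord i x) = x;
  m_coord_cont : forall i, {in mdom i, continuous (mcoord i)};
  m_par_cont : forall i, {in mcoord i @` mdom i, continuous (mpar i)};
  m_transition : forall i j a,
    smooth_on (mcoord i @` (mdom i `&` mdom j))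
              (fun y => mcoord j (mpar i y) 0 a)
}.
Arguments mdom {R n} m _.
Arguments mcoord {R n} m _ _.
Arguments mpar {R n} m _ _.

Definition charts (R : realType) (n : nat) (M : manifold R n) : coord_space R n :=
  CoordSpace (mdom M) (mcoord M).

(* The derivative of the a-th coordinate of chart j with respect to the b-th
   coordinate of chart i. *)
Definition jac (R : realType) (n : nat) (M : manifold R n) (i j : mchart M)
    (x : M) (a b : 'I_n) : R :=
  partial (fun y => mcoord M j (mpar M i y) 0 a) b (mcoord M i x).

Definition smooth_function (R : realType) (n : nat) (M : manifold R n)
    (f : M -> R) : Prop :=
  forall i, smooth_on (mcoord M i @` mdom M i) (f \o mpar M i).

(* Components of a (0,2)-tensor field in each chart, as functions of the
   coordinates. *)
Definition bilinear_field (R : realType) (d : nat) (X : coord_space R d) :=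
  chart X -> 'rV[R]_d -> 'M[R]_d.

Definition bform (R : realType) (d : nat) (A : 'M[R]_d) (u v : 'rV[R]_d) : R :=
  (u *m A *m v^T) 0 0.

Definition riemannian_metric (R : realType) (n : nat) (M : manifold R n)
    (g : bilinear_field (charts M)) : Prop :=
  [/\ forall i a b, smooth_on (mcoord M i @` mdom M i) (fun y => g i y a b),
      forall i x, mdom M i x -> (g i (mcoord M i x))^T = g i (mcoord M i x),
      forall i x, mdom M i x ->
        forall u, u != 0 -> 0 < bform (g i (mcoord M i x)) u u
    & forall i j x, mdom M i x -> mdom M j x -> forall a b,
        g j (mcoord M j x) a b =
        \sum_c \sum_d jac j i x c a * jac j i x d b * g i (mcoord M i x) c d].

(* Gam i y h a b is the coefficient Gamma^h_(ab) in chart i at coordinates y. *)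
Definition connection (R : realType) (d : nat) (X : coord_space R d) :=
  chart X -> 'rV[R]_d -> 'I_d -> 'I_d -> 'I_d -> R.

(* Torsion-free and compatible with the metric. The coefficients are thereby
   determined on the image of each chart, hence transform as those of a
   connection. *)
Definition levi_civita (R : realType) (d : nat) (X : coord_space R d)
    (g : bilinear_field X) (Gam : connection X) : Prop :=
  forall (i : chart X) (y : 'rV[R]_d), (chart_coord X i @` chart_dom X i) y ->
    (forall h a b, Gam i y h a b = Gam i y h b a) /\
    (forall c a b, partial (fun z => g i z a b) c y =
       \sum_l (Gam i y l c a * g i y l b + Gam i y l c b * g i y a l)).

Definition curve_coord (R : realType) (d : nat) (X : coord_space R d)
    (gam : R -> cs_point X) (i : chart X) (a : 'I_d) : R -> R :=
  fun t => chart_coord X i (gam t) 0 a.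

(* Curves are functions on R of which only the restriction to the open interval
   J matters. *)
Definition smooth_curve (R : realType) (d : nat) (X : coord_space R d)
    (J : set R) (gam : R -> cs_point X) : Prop :=
  forall t, J t -> forall i, chart_dom X i (gam t) ->
    (\forall s \near t, chart_dom X i (gam s)) /\
    (forall a k, derivable (derive1n k (curve_coord gam i a)) t 1).

Definition geodesic (R : realType) (d : nat) (X : coord_space R d)
    (Gam : connection X) (J : set R) (gam : R -> cs_point X) : Prop :=
  smooth_curve J gam /\
  forall t, J t -> forall i, chart_dom X i (gam t) -> forall h,
    derive1n 2 (curve_coord gam i h) t
    + \sum_a \sum_b Gam i (chart_coord X i (gam t)) h a b
                    * derive1 (curve_coord gam i a) t
                    * derive1 (curve_coord gam i b) t = 0.

(* Multi-indices of a (p,q)-tensor: contravariant, then covariant indices. *)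
Definition tidx (n p q : nat) : finType :=
  ({ffun 'I_p -> 'I_n} * {ffun 'I_q -> 'I_n})%type.

Definition upd (n r : nat) (k : {ffun 'I_r -> 'I_n}) (l : 'I_r) (m : 'I_n) :
    {ffun 'I_r -> 'I_n} :=
  [ffun a => if a == l then m else k a].

(* A tensor at x is given by its components in all charts around x; the
   condition tcomp_out only fixes the values in the irrelevant charts. *)
Record tensor (R : realType) (n : nat) (M : manifold R n) (p q : nat) (x : M) :=
  Tensor {
  tcomp : mchart M -> tidx n p q -> R;
  tcomp_out : forall i k, ~ mdom M i x -> tcomp i k = 0;
  tcomp_transform : forall i j, mdom M i x -> mdom M j x ->
    forall k : tidx n p q,
    tcomp j k = \sum_(c : tidx n p q)
      (\prod_(l < p) jac i j x (k.1 l) (c.1 l)) *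
      (\prod_(m < q) jac j i x (c.2 m) (k.2 m)) * tcomp i c
}.

Definition tensor_row (R : realType) (n p q : nat) (t : tidx n p q -> R) :
    'rV[R]_#|tidx n p q| :=
  \row_k t (enum_val k).

(* The bundle T^p_q(M) with its induced coordinates (x, t). *)
Definition tensor_bundle (R : realType) (n : nat) (M : manifold R n) (p q : nat) :
    coord_space R (n + #|tidx n p q|) :=
  @CoordSpace R (n + #|tidx n p q|) {x : M & tensor p q x} (mchart M)
    (fun i u => mdom M i (tag u))
    (fun i u => row_mx (mcoord M i (tag u)) (tensor_row (tcomp (tagged u) i))).

Definition vlift (R : realType) (n p q : nat) (A : tidx n p q -> R) :
    'rV[R]_(n + #|tidx n p q|) :=
  row_mx 0 (tensor_row A).

(* Gam: the connection coefficients at the base point; t: the fibre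
   coordinates of the point where the lift is taken. *)
Definition hlift (R : realType) (n p q : nat) (Gam : 'I_n -> 'I_n -> 'I_n -> R)
    (t : tidx n p q -> R) (X : 'rV[R]_n) : 'rV[R]_(n + #|tidx n p q|) :=
  row_mx X (tensor_row (fun k : tidx n p q =>
    \sum_s X 0 s *
      (\sum_(mu < q) \sum_m Gam m s (k.2 mu) * t (k.1, upd k.2 mu m)
       - \sum_(la < p) \sum_m Gam (k.1 la) s m * t (upd k.1 la m, k.2)))).

Definition tensor_inner (R : realType) (n p q : nat) (g : 'M[R]_n)
    (A B : tidx n p q -> R) : R :=
  \sum_(k : tidx n p q) \sum_(c : tidx n p q)
    (\prod_(l < p) g (k.1 l) (c.1 l)) *
    (\prod_(m < q) (invmx g) (k.2 m) (c.2 m)) * A k * B c.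

(* G is the metric Sg_f. Since tensors and vectors at a point extend to fields,
   the defining equations are written pointwise, at the point of the bundle with
   induced coordinates (mcoord M i x, t). *)
Definition rescaled_sasaki (R : realType) (n : nat) (M : manifold R n) (p q : nat)
    (g : bilinear_field (charts M)) (Gam : connection (charts M)) (f : M -> R)
    (G : bilinear_field (tensor_bundle M p q)) : Prop :=
  forall (i : mchart M) (x : M) (t : tidx n p q -> R), mdom M i x ->
  let y := mcoord M i x in
  let Gxt := G i (row_mx y (tensor_row t)) in
  [/\ Gxt^T = Gxt,
      forall A B : tidx n p q -> R,
        bform Gxt (vlift A) (vlift B) = tensor_inner (g i y) A B,
      forall (A : tidx n p q -> R) (Y : 'rV[R]_n),
        bform Gxt (vlift A) (hlift (Gam i y) t Y) = 0
    & forall X Y : 'rV[R]_n,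
        bform Gxt (hlift (Gam i y) t X) (hlift (Gam i y) t Y)
        = f x * bform (g i y) X Y].

Definition lift_curve (R : realType) (n : nat) (M : manifold R n) (p q : nat)
    (gam : R -> M) (S : forall t, tensor p q (gam t)) :
    R -> cs_point (tensor_bundle M p q) :=
  fun t => Tagged (fun x : M => tensor p q x) (S t).

Definition parallel_along (R : realType) (n : nat) (M : manifold R n) (p q : nat)
    (Gam : connection (charts M)) (J : set R) (gam : R -> M)
    (S : forall t, tensor p q (gam t)) : Prop :=
  forall t, J t -> forall i, mdom M i (gam t) -> forall k : tidx n p q,
    let x := mcoord M i (gam t) in
    derive1 (fun s => tcomp (S s) i k) t
    + \sum_s derive1 (@curve_coord R n (charts M) gam i s) t *
        (\sum_(la < p) \sum_m Gam i x (k.1 la) s m * tcomp (S t) i (upd k.1 la m, k.2)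
         - \sum_(mu < q) \sum_m Gam i x m s (k.2 mu) * tcomp (S t) i (k.1, upd k.2 mu m))
    = 0.

(* The curve lift_curve S is a horizontal lift of gam on J. *)
Definition horizontal_lift (R : realType) (n : nat) (M : manifold R n) (p q : nat)
    (Gam : connection (charts M)) (J : set R) (gam : R -> M)
    (S : forall t, tensor p q (gam t)) : Prop :=
  smooth_curve J (lift_curve S) /\ parallel_along Gam J S.

(* The objects characterized by levi_civita and rescaled_sasaki exist. *)

Lemma riemannian_metric_unit (R : realType) (n : nat) (M : manifold R n)
    (g : bilinear_field (charts M)) (i : mchart M) (x : M) :
  riemannian_metric g -> mdom M i x -> g i (mcoord M i x) \in unitmx.
Proof.
move=> [_ _ gpos _] ix; rewrite -row_free_unit -kermx_eq0; apply/eqP/row_matrixP.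
move=> k; rewrite row0; apply/eqP; apply: contraT => /(gpos i x ix).
by rewrite /bform -row_mul mulmx_ker row0 mul0mx mxE ltxx.
Qed.

Lemma levi_civita_exists (R : realType) (d : nat) (X : coord_space R d)
    (g : bilinear_field X) :
  (forall i y, (chart_coord X i @` chart_dom X i) y ->
     (\forall z \near y, (g i z)^T = g i z) /\ g i y \in unitmx) ->
  exists Gam : connection X, levi_civita g Gam.
Proof.
move=> gP; pose dg i y a b c := partial (fun z => g i z a b) c y.
pose low i y a b k := (dg i y k b a + dg i y k a b - dg i y a b k) / 2.
exists (fun i y h a b => \sum_k low i y a b k * invmx (g i y) k h) => i y iy.
have [gs gu] := gP i y iy.
have gsy : (g i y)^T = g i y by exact: nbhs_singleton gs.
have dgC a b c : dg i y a b c = dg i y b a c.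
  apply: near_eq_derive; apply: filterS gs => z zs.
  by rewrite -[in LHS]zs mxE.
have lowE a b c : \sum_l (\sum_k low i y a b k * invmx (g i y) k l) * g i y l c
    = low i y a b c.
  transitivity (((\row_k low i y a b k) *m invmx (g i y) *m g i y) 0 c).
    rewrite [RHS]mxE; apply: eq_bigr => l _; congr (_ * _).
    by rewrite mxE; apply: eq_bigr => k _; rewrite mxE.
  by rewrite -mulmxA mulVmx // mulmx1 mxE.
split=> [h a b|c a b].
  apply: eq_bigr => k _; congr (_ * _); rewrite /low (dgC a b).
  by rewrite [dg i y k b a + _]addrC.
rewrite big_split /= lowE.
under [X in _ + X]eq_bigr => l _ do rewrite -[g i y]gsy mxE gsy.
rewrite lowE /low -/(dg i y a b c) (dgC b a) (dgC b c) (dgC a c).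
by field.
Qed.

Lemma riemannian_levi_civita_exists (R : realType) (n : nat) (M : manifold R n)
    (g : bilinear_field (charts M)) :
  riemannian_metric g -> exists Gam : connection (charts M), levi_civita g Gam.
Proof.
move=> gR; apply: levi_civita_exists => i y iy; split; last first.
  by case: iy => x ix <-; exact: riemannian_metric_unit.
have : \forall z \near y, (mcoord M i @` mdom M i) z.
  by apply: open_nbhs_nbhs; split=> //; exact: m_image_open.
by apply: filterS => z [x ix <-]; case: gR => _ gs _ _; exact: gs.
Qed.

Lemma rescaled_sasaki_exists (R : realType) (n : nat) (M : manifold R n)
    (p q : nat) (g : bilinear_field (charts M)) (Gam : connection (charts M))
    (f : M -> R) :
  riemannian_metric g -> (forall x, 0 < f x) ->
  exists Sgf : bilinear_field (tensor_bundle M p q),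
    rescaled_sasaki g Gam f Sgf /\
    exists Gamhat : connection (tensor_bundle M p q), levi_civita Sgf Gamhat.
Proof.
move=> gR f0; set N := #|tidx n p q|.
pose ev (k : 'I_N) : tidx n p q := enum_val k.
pose V (h h' : 'M[R]_n) : 'M[R]_N := \matrix_(k, c)
  ((\prod_(l < p) h ((ev k).1 l) ((ev c).1 l)) *
   (\prod_(m < q) h' ((ev k).2 m) ((ev c).2 m))).
have VV h h' : h *m h' = 1%:M -> V h h' *m V h' h = 1%:M.
  move=> hh'; have h'h := mulmx1C hh'; apply/matrixP => k c; rewrite !mxE.
  under eq_bigr => j _ do rewrite !mxE mulrACA -!big_split /=.
  rewrite (reindex_onto (enum_rank : tidx n p q -> 'I_N) ev) /=; last first.
    by move=> j _; rewrite /ev enum_valK.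
  under eq_bigl => j do rewrite /ev enum_rankK eqxx.
  under eq_bigr => j _ do rewrite /ev enum_rankK -/(ev k) -/(ev c).
  rewrite -(pair_bigA _ (fun (a : {ffun 'I_p -> 'I_n}) (b : {ffun 'I_q -> 'I_n}) =>
    (\prod_(l < p) (h ((ev k).1 l) (a l) * h' (a l) ((ev c).1 l))) *
    (\prod_(m < q) (h' ((ev k).2 m) (b m) * h (b m) ((ev c).2 m))))) /=.
  rewrite -big_distrlr /=.
  rewrite -(bigA_distr_bigA (fun (l : 'I_p) a =>
    h ((ev k).1 l) a * h' a ((ev c).1 l))).
  rewrite -(bigA_distr_bigA (fun (m : 'I_q) b =>
    h' ((ev k).2 m) b * h b ((ev c).2 m))) /=.
  under eq_bigr => l _.
    have /matrixP/(_ ((ev k).1 l) ((ev c).1 l)) := hh'.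
    rewrite !mxE => ->; over.
  under [X in _ * X]eq_bigr => l _.
    have /matrixP/(_ ((ev k).2 l) ((ev c).2 l)) := h'h.
    rewrite !mxE => ->; over.
  have [<-|kc] := eqVneq k c.
    by rewrite !big1 ?mulr1 // => l _; rewrite eqxx.
  have /eqP : ev k != ev c.
    by apply: contra kc => /eqP/enum_val_inj ->.
  case: (ev k) (ev c) => [a b] [a' b'] /= ab.
  have [aa|aa] := eqVneq a a'; last first.
    have [l al] : exists l, a l != a' l.
      apply/existsP; apply: contraT => /existsPn al; case/eqP: aa.
      by apply/ffunP => l; apply/eqP; have := al l; rewrite negbK.
    by rewrite (bigD1 l) //= (negPf al) mulr0n !mul0r.
  have [l bl] : exists l, b l != b' l.
    apply/existsP; apply: contraT => /existsPn bl; case: ab; rewrite aa; congr pair.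
    by apply/ffunP => l; apply/eqP; have := bl l; rewrite negbK.
  by rewrite [X in _ * X](bigD1 l) //= (negPf bl) mulr0n mul0r mulr0.
have VT h h' : (V h h')^T = V h^T h'^T.
  apply/matrixP => k c; rewrite !mxE.
  by congr (_ * _); apply: eq_bigr => l _; rewrite mxE.
pose K i y (t : tidx n p q -> R) : 'M[R]_(n, N) :=
  \matrix_(s, k) hlift (Gam i y) t (delta_mx 0 s) 0 (rshift n k).
pose P i y t : 'M[R]_(n + N) := block_mx 1%:M (K i y t) 0 1%:M.
pose D i y : 'M[R]_(n + N) :=
  block_mx (f (mpar M i y) *: g i y) 0 0 (V (g i y) (invmx (g i y))).
pose t (y : 'rV[R]_(n + N)) c := rsubmx y 0 (enum_rank c).
pose G0 i (y : 'rV[R]_(n + N)) := let Q := invmx (P i (lsubmx y) (t y)) in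
  Q *m D i (lsubmx y) *m Q^T.
pose im i (y : 'rV[R]_(n + N)) := (mcoord M i @` mdom M i) (lsubmx y).
pose G : bilinear_field (tensor_bundle M p q) :=
  fun i y => if `[< im i y >] then G0 i y else 1%:M.
have Pu i y tt : P i y tt \in unitmx.
  by rewrite unitmxE det_ublock !det1 mulr1 unitr1.
have gu i y : (mcoord M i @` mdom M i) y -> g i y \in unitmx.
  by move=> [x ix <-]; exact: riemannian_metric_unit.
have gs i y : (mcoord M i @` mdom M i) y -> (g i y)^T = g i y.
  by move=> [x ix <-]; case: gR => _ gs _ _; exact: gs.
have Ds i y : (mcoord M i @` mdom M i) y -> (D i y)^T = D i y.
  move=> iy; rewrite /D tr_block_mx !trmx0 linearZ /= VT trmx_inv.
  by rewrite (gs i y iy).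
have Du i y : (mcoord M i @` mdom M i) y -> D i y \in unitmx.
  move=> iy; rewrite unitmxE det_ublock unitrM -!unitmxE.
  apply/andP; split.
    rewrite unitmxZ ?gu // unitfE gt_eqF //.
  by have [] := mulmx1_unit (VV _ _ (mulmxV (gu i y iy))).
have Gs i y : (G i y)^T = G i y.
  rewrite /G; case: asboolP => [iy|_]; last by rewrite trmx1.
  by rewrite /G0 !trmx_mul trmxK Ds // mulmxA.
exists G; split; last first.
  apply: levi_civita_exists => i y [[x tx] /= ix yE]; split.
    by apply: (@filterE _ (nbhs y)) => z; exact: Gs.
  have iy : (mcoord M i @` mdom M i) (lsubmx y).
    by exists x => //; rewrite -yE row_mxKl.
  rewrite /G asboolT // /G0 !unitmx_mul unitmx_tr !unitmx_inv !Pu Du //.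
move=> i x tt ix /=.
have iy : (mcoord M i @` mdom M i) (mcoord M i x) by exists x.
set y := mcoord M i x in iy *.
have tE : t (row_mx y (tensor_row tt)) = tt.
  by apply/funext => c; rewrite /t row_mxKr mxE enum_rankK.
have vE A : vlift A = row_mx 0 (tensor_row A) *m P i y tt.
  by rewrite /vlift /P mul_row_block !mul0mx mulmx0 !add0r mulmx1.
have hE X : hlift (Gam i y) tt X = row_mx X 0 *m P i y tt.
  rewrite /P mul_row_block !mul0mx !addr0 mulmx1 /hlift; congr row_mx.
  apply/rowP => k; rewrite !mxE; apply: eq_bigr => s _; congr (_ * _).
  rewrite [RHS]mxE /hlift row_mxEr mxE (bigD1 s) //= mxE !eqxx mul1r.
  rewrite [X in _ = _ + X]big1 ?addr0 //.
  by move=> s' /negPf ss'; rewrite mxE eqxx ss' mul0r.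
have GE : G i (row_mx y (tensor_row tt)) =
    invmx (P i y tt) *m D i y *m (invmx (P i y tt))^T.
  by rewrite /G asboolT /im ?row_mxKl // /G0 row_mxKl tE.
have bE u v : bform (G i (row_mx y (tensor_row tt))) (u *m P i y tt) (v *m P i y tt)
    = (u *m D i y *m v^T) 0 0.
  rewrite /bform GE trmx_mul !mulmxA mulmxK // -[_ *m (invmx _)^T *m _]mulmxA.
  by rewrite -trmx_mul mulmxV // trmx1 mulmx1.
split=> [|A B|A Y|X Y]; first exact: Gs.
- rewrite !vE bE /D mul_row_block !mul0mx !add0r mulmx0 tr_row_mx mul_row_col.
  rewrite trmx0 mulmx0 add0r /tensor_inner mxE.
  rewrite exchange_big /= (reindex_onto (enum_val : 'I_N -> tidx n p q) enum_rank) /=; last first.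
    by move=> j _; rewrite enum_rankK.
  rewrite [RHS](eq_bigl xpredT); last by move=> j; rewrite enum_valK eqxx.
  apply: eq_bigr => c _; rewrite !mxE mulr_suml.
  rewrite [RHS](reindex_onto (enum_val : 'I_N -> tidx n p q) enum_rank) /=; last first.
    by move=> j _; rewrite enum_rankK.
  rewrite [RHS](eq_bigl xpredT); last by move=> j; rewrite enum_valK eqxx.
  by apply: eq_bigr => k _; rewrite !mxE; ring.
- rewrite vE hE bE /D mul_row_block !mul0mx !add0r mulmx0 tr_row_mx mul_row_col.
  by rewrite trmx0 mulmx0 mul0mx addr0 mxE.
- rewrite !hE bE /D mul_row_block !mul0mx !mulmx0 !addr0 tr_row_mx mul_row_col.
  rewrite mul0mx addr0 -scalemxAr -scalemxAl mxE /bform; congr (_ * _).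
  by congr f; exact: m_coordK.
Qed.

(* Main.v *)
Require Import Defs.
From HB Require Import structures.
From mathcomp Require Import all_boot all_order all_algebra.
From mathcomp Require Import all_classical all_reals all_analysis.
From mathcomp Require Import ring lra.
Import Order.TTheory GRing.Theory Num.Theory.
Import numFieldNormedType.Exports.
Local Open Scope classical_set_scope.
Local Open Scope ring_scope.
Set Implicit Arguments.
Unset Strict Implicit.
Unset Printing Implicit Defensive.

(** Let G be the matrix of a metric in a chart and x a curve with velocity v.
The geodesic equation of the Levi-Civita connection of G is equivalent to the
Euler-Lagrange equations of the kinetic energy,
   d/dt (sum_b G_cb v_b) = d_c (G(v, v) / 2)   for all c,
where the derivative d_c on the right is taken at fixed v
(euler_lagrange_christoffel). In this form nothing but the metric appears,
which is what makes the tensor bundle tractable: the Christoffel symbols of the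
rescaled Sasaki metric involve the curvature of M, but the metric itself is
   Sgf(u, w) = f g(u1, w1) + h(A_u, A_w),
where u1 is the projection of u to M, A_u is the vertical part of u (what
remains of u after subtracting the horizontal lift of u1) and h is the metric
of the fibres (sasaki_formula).

Along a horizontal lift of a curve the velocity is horizontal: its vertical part
vanishes, this being the meaning of parallel transport. Hence the term h(A, A)
contributes neither to the momentum nor, since it is quadratic in A, to the
gradient of the energy. The Euler-Lagrange equations of the lift are therefore
void in the directions of the fibre, and in the directions of M they are those of
the metric f g. When the curve gamma on M is a geodesic of g, they reduce to
   (f o gamma)' g(e_a, gamma') = d_a f g(gamma', gamma') / 2   for all a
(lift_geodesic_eqP).

If f is constant, both sides vanish. Conversely, the zero section is parallel
along every geodesic. Contracting the equation for its lift with gamma' gives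
(f o gamma)' |gamma'|^2 = (f o gamma)' |gamma'|^2 / 2, so the derivative of f
along gamma' is zero. Since there are geodesics with any given initial velocity
(geodesic_exists), the differential of f vanishes, and f is constant because M
is connected.

The existence of geodesics takes two steps. In one chart, the geodesic equation is
a first order system with locally Lipschitz right-hand side, solved by Picard
iteration (ode_exists). The solution must then satisfy the geodesic equations of
all other charts. This holds because the Euler-Lagrange expression is a covector
(euler_lagrange_change), which in turn rests on the symmetry of second partial
derivatives (schwarz). *)

(** * Differential calculus in several variables *)

(** Reduces directional derivatives to functions of one variable, for which the
mean value theorem and the chain rule are available. *)
Lemma is_derive_line (R : realType) (V W : normedModType R) (F : V -> W)
    (y v : V) (t : R) (df : W) :
  is_derive t 1 (fun s : R => F (y + s *: v)) df <-> is_derive (y + t *: v) v F df.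
Proof.
have E : (fun h : R => h^-1 *: (((fun s => F (y + s *: v)) \o shift t) (h *: 1)
             - F (y + t *: v)))
       = (fun h : R => h^-1 *: ((F \o shift (y + t *: v)) (h *: v) - F (y + t *: v))).
  apply/funext => h /=; congr (_ *: (F _ - _)).
  by rewrite [h *: 1]mulr1 scalerDl addrCA.
by split=> -[dF <-]; split; rewrite /derivable /derive -?E // E.
Qed.

Lemma is_derive_scale (R : realType) (V : normedModType R) (F : V -> R)
    (y v : V) (c df : R) :
  is_derive y v F df -> is_derive y (c *: v) F (c * df).
Proof.
move=> Fy; have : is_derive (y + 0 *: (c *: v)) (c *: v) F (c * df); last first.
  by rewrite scale0r addr0.
apply/is_derive_line.
have -> : (fun s : R => F (y + s *: (c *: v))) =
    (fun s => F (y + s *: v)) \o (fun s => c * s).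
  by apply/funext => s /=; rewrite scalerA mulrC.
have h1 : is_derive (c * 0 : R) 1 (fun s => F (y + s *: v)) df.
  by apply/is_derive_line; rewrite mulr0 scale0r addr0.
have h2 : is_derive (0 : R) 1 (fun s : R => c * s) c.
  have := @is_deriveZ R R R id c 0 1 1 (is_derive_id _ _).
  by rewrite [c *: 1]mulr1.
by rewrite mulrC; exact: is_derive1_comp.
Qed.

Lemma mean_value_segment (R : realType) (V : normedModType R) (F : V -> R) (y v : V) :
  (forall t : R, 0 <= t <= 1 -> derivable F (y + t *: v) v) ->
  exists2 t : R, 0 <= t <= 1 & F (y + v) - F y = 'D_v F (y + t *: v).
Proof.
move=> dF.
have dl (t : R) : 0 <= t <= 1 ->
    is_derive t 1 (fun s : R => F (y + s *: v)) ('D_v F (y + t *: v)).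
  by move=> t01; apply/is_derive_line/derivableP/dF.
have [||t t01] := @MVT_segment R (fun s : R => F (y + s *: v))
    (fun s => 'D_v F (y + s *: v)) 0 1 ler01.
- move=> t; rewrite in_itv /= => /andP[t0 t1]; apply: dl.
  by rewrite !ltW.
- apply: derivable_within_continuous => t; rewrite in_itv /= => t01.
  by case: (dl t t01).
- by rewrite subr0 mulr1 scale1r scale0r addr0 => ->; exists t.
Qed.

Lemma near_all (T : topologicalType) (I : finType) (P : I -> T -> Prop) (x : T) :
  (forall i, \forall y \near x, P i y) -> \forall y \near x, forall i, P i y.
Proof. exact: (@filter_forall T I P (nbhs x)). Qed.

Lemma near_and (T : topologicalType) (P Q : T -> Prop) (x : T) :
  (\forall y \near x, P y) -> (\forall y \near x, Q y) ->
  \forall y \near x, P y /\ Q y.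
Proof. exact: filterI. Qed.

Lemma mx_ballP (R : realType) d (z : 'rV[R]_d) r y :
  ball z r y <-> 0 < r /\ forall a, `|z 0 a - y 0 a| < r.
Proof.
split=> [[r0 zy]|[r0 zy]]; split=> //; first by move=> a; exact: zy.
by move=> i a; rewrite ord1; exact: zy.
Qed.

Lemma coord_le_norm (R : realType) d (x : 'rV[R]_d) a : `|x 0 a| <= `|x|.
Proof.
rewrite [leRHS]/Num.Def.normr /= mx_normrE.
exact: (le_bigmax _ (fun ij => `|x ij.1 ij.2|) (0, a)).
Qed.

Lemma norm_le_coord (R : realType) d (x : 'rV[R]_d) e :
  0 <= e -> (forall a, `|x 0 a| <= e) -> `|x| <= e.
Proof.
move=> e0 xe; rewrite /Num.Def.normr /= mx_normrE bigmax_le // => -[i a] _.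
by rewrite ord1; exact: xe.
Qed.

Lemma segment_lt (R : realType) (z u w r t : R) : 0 <= t <= 1 ->
  `|z - u| < r -> `|z - w| < r -> `|z - (u + t * (w - u))| < r.
Proof.
move=> /andP[t0 t1] zu zw.
have -> : z - (u + t * (w - u)) = (1 - t) * (z - u) + t * (z - w) by ring.
apply: le_lt_trans (ler_normD _ _) _; rewrite !normrM (ger0_norm t0).
rewrite (@ger0_norm _ (1 - t)) ?subr_ge0 //.
set m := Num.max `|z - u| `|z - w|.
have mr : m < r by rewrite gt_max zu zw.
apply: le_lt_trans mr; have zum : `|z - u| <= m by rewrite le_max lexx.
have zwm : `|z - w| <= m by rewrite le_max lexx orbT.
nra.
Qed.

(** Moving from u to w one coordinate at a time stays in the ball, because balls
of the sup norm are boxes; each move is governed by the mean value theorem in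
one variable. *)
Lemma mean_value_coords (R : realType) d (F : 'rV[R]_d -> R) (z u w : 'rV[R]_d) r :
  (forall y : 'rV[R]_d, ball z r y -> forall a : 'I_d, derivable F y 'e_a) ->
  ball z r u -> ball z r w ->
  exists2 xi : 'I_d -> 'rV[R]_d, forall a, ball z r (xi a) &
    F w - F u = \sum_a (w 0 a - u 0 a) * partial F a (xi a).
Proof.
move=> dF zu zw; pose P k : 'rV[R]_d := \row_b (if (b < k)%N then w 0 b else u 0 b).
have PS (a : 'I_d) : P a.+1 = P a + (w 0 a - u 0 a) *: 'e_a.
  apply/rowP => b; rewrite !mxE ltnS leq_eqVlt eqxx /=.
  have [->|ba] := eqVneq b a.
    by rewrite eqxx ltnn mulr1 addrC subrK.
  by rewrite (negPf (_ : _ != _)) // mulr0 addr0.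
have Pb (a : 'I_d) (t : R) : 0 <= t <= 1 -> ball z r (P a + t *: ((w 0 a - u 0 a) *: 'e_a)).
  move/mx_ballP: zu => [r0 zu]; move/mx_ballP: zw => [_ zw] t01; apply/mx_ballP.
  split=> // b; rewrite !mxE eqxx /=.
  have [->|ba] := eqVneq b a; last by rewrite !mulr0 addr0; case: ifP.
  rewrite ltnn mulr1; exact: segment_lt.
have step (a : 'I_d) : exists y : 'rV[R]_d, ball z r y /\
    F (P a.+1) - F (P a) = (w 0 a - u 0 a) * partial F a y.
  have dFa (t : R) : 0 <= t <= 1 ->
      let y := P a + t *: ((w 0 a - u 0 a) *: 'e_a) in
      is_derive y ((w 0 a - u 0 a) *: 'e_a) F ((w 0 a - u 0 a) * partial F a y).
    by move=> t01 y; apply: is_derive_scale; apply: derivableP; apply: dF; exact: Pb.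
  rewrite PS.
  have [t t01|t t01 ->] := @mean_value_segment _ _ F (P a) ((w 0 a - u 0 a) *: 'e_a).
    by case: (dFa t t01).
  exists (P a + t *: ((w 0 a - u 0 a) *: 'e_a)); split; first exact: Pb.
  by case: (dFa t t01).
have [xi xiP] := choice step.
exists xi => [a|]; first by case: (xiP a).
under eq_bigr => a _ do rewrite -(proj2 (xiP a)).
rewrite -(big_mkord xpredT (fun a => F (P a.+1) - F (P a))) telescope_sumr //.
congr (F _ - F _); apply/rowP => b; rewrite mxE //.
by rewrite ltn_ord.
Qed.

Lemma norm_sum_coord (R : realType) d (c : 'I_d -> R) (x : 'rV[R]_d) e :
  (forall a, `|c a| <= e) -> `|\sum_a x 0 a * c a| <= d%:R * e * `|x|.
Proof.
move=> ce; apply: le_trans (ler_norm_sum _ _ _) _.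
apply: (@le_trans _ _ (\sum_(a < d) e * `|x|)); last first.
  by rewrite sumr_const card_ord -mulrA mulr_natl.
apply: ler_sum => a _; rewrite normrM mulrC ler_pM //; exact: coord_le_norm.
Qed.

Definition lin_form (R : realType) d (c : 'I_d -> R) (h : 'rV[R]_d) : R :=
  \sum_a h 0 a * c a.

Lemma lin_form_is_linear (R : realType) d (c : 'I_d -> R) : linear (lin_form c).
Proof.
move=> k u v; rewrite /lin_form scaler_sumr -big_split /=; apply: eq_bigr => a _.
by rewrite !mxE mulrDl -mulrA.
Qed.

Lemma lin_form_continuous (R : realType) d (c : 'I_d -> R) : continuous (lin_form c).
Proof.
apply: continuous_big => [|a _ h]; first exact: add_continuous.
apply: (@continuousM R _ (fun x : 'rV[R]_d => x 0 a) (cst (c a)) h); [exact: coord_continuous|exact: cst_continuous].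
Qed.

(** The differential of a map is defined by a choice among the linear maps that
approximate it; this criterion accepts any explicit candidate L. *)
Lemma differentiable_littleo (K : numFieldType) (V W : normedModType K) (F : V -> W)
    (L : V -> W) (z : V) : linear L -> continuous L ->
  (forall e : K, 0 < e -> \forall h \near (0 : V), `|F (h + z) - F z - L h| <= e * `|h|) ->
  differentiable F z.
Proof.
move=> linL cL FL; pose L' := HB.pack_for {linear V -> W} L (GRing.isLinear.Build K V W _ L linL).
have FE : F \o shift z = cst (F z) + L' +o_ 0 id.
  by apply/eqaddoP => e e0; near do rewrite !fctE /= opprD addrA; exact: FL.
by apply/diff_locallyP; rewrite (@diff_unique _ _ _ F L' z cL FE).
Unshelve. all: by end_near. Qed.

(** By the mean value theorem the increment of F is the linear form whose
coefficients are partial derivatives at points near z, and these are close to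
the partial derivatives at z by continuity. *)
Lemma differentiable_of_C1 (R : realType) d (F : 'rV[R]_d -> R) (z : 'rV[R]_d) :
  (\forall y \near z, forall a, derivable F y 'e_a) ->
  (forall a, {for z, continuous (partial F a)}) ->
  differentiable F z.
Proof.
move=> dF cF; pose c a := partial F a z.
apply: (@differentiable_littleo _ _ _ F (lin_form c)) => [||e e0].
  exact (@lin_form_is_linear R d c).
  exact (@lin_form_continuous R d c).
pose e' := e / d.+1%:R.
have e'0 : 0 < e' by rewrite divr_gt0 // ltr0n.
have near_c : \forall y \near z, forall a, `|partial F a y - c a| <= e'.
  apply: near_all => a; move/cvgrPdist_le: (cF a) => /(_ e' e'0).
  by apply: filterS => y; rewrite distrC.
have /nbhs_ballP[r /= r0 rP] : \forall y \near z,
    (forall a, derivable F y 'e_a) /\ (forall a, `|partial F a y - c a| <= e').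
  by apply: filterI.
near=> h.
have hz : ball z r (h + z).
  apply/mx_ballP; split=> // a; rewrite !mxE opprD addrCA subrr addr0 normrN.
  apply: le_lt_trans (coord_le_norm h a) _.
  by near: h; exact: (@nbhs0_lt _ 'rV[R]_d r r0).
have [|xi xib ->] := @mean_value_coords _ _ F z _ _ r _ (ballxx z r0) hz.
  by move=> y /rP[].
rewrite /lin_form -sumrB.
under eq_bigr => a _ do rewrite mxE addrK -mulrBr.
apply: le_trans (norm_sum_coord _ (e := e') _) _ => [a|].
  by have [_] := rP _ (xib a); apply.
rewrite ler_wpM2r // /e' mulrC -mulrA ler_piMr ?(ltW e0) //.
by rewrite mulrC ler_pdivrMr ?ltr0n // mul1r ler_nat.
Unshelve. all: by end_near. Qed.

Lemma differentiable_deriveE (R : realType) d (F : 'rV[R]_d -> R) (z v : 'rV[R]_d) :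
  differentiable F z -> 'D_v F z = \sum_a v 0 a * partial F a z.
Proof.
move=> dF; rewrite deriveE // {1}(row_sum_delta v) linear_sum /=.
by apply: eq_bigr => a _; rewrite linearZ /= /partial deriveE.
Qed.

Lemma is_derive_curve (R : realType) d (F : 'rV[R]_d -> R) (x : R -> 'rV[R]_d) (t : R)
    (v : 'rV[R]_d) :
  differentiable F (x t) -> (forall a, is_derive t 1 (fun s => x s 0 a) (v 0 a)) ->
  is_derive t 1 (F \o x) (\sum_a v 0 a * partial F a (x t)).
Proof.
move=> dF dx.
have dxt : derivable x t 1.
  by apply/derivable_mxP => i a; rewrite ord1; case: (dx a).
have Dx : 'D_1 x t = v.
  rewrite derive_mx //; apply/rowP => a; rewrite mxE; by case: (dx a).
have dxt' : differentiable x t by apply/derivable1_diffP.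
have dFx : differentiable (F \o x) t by exact: differentiable_comp.
apply: DeriveDef; first exact: diff_derivable.
by rewrite deriveE // diff_comp //= -(deriveE (1 : R) dxt') Dx -(deriveE v dF) differentiable_deriveE.
Qed.

(** The mean value theorem is applied twice: along u to the function
y |-> F (y + v) - F y, then along v to the derivative G of F along u. *)
Lemma second_difference (R : realType) (V : normedModType R) (F G H : V -> R) (z u v : V) :
  (forall s t : R, 0 <= s <= 1 -> 0 <= t <= 1 ->
     let y := z + s *: u + t *: v in is_derive y u F (G y) /\ is_derive y v G (H y)) ->
  exists s t : R, [/\ 0 <= s <= 1, 0 <= t <= 1 &
    F (z + u + v) - F (z + u) - F (z + v) + F z = H (z + s *: u + t *: v)].
Proof.
move=> dF; pose D y := F (y + v) - F y.
have shiftv (y : V) df : is_derive (y + v) u F df -> is_derive y u (fun w => F (w + v)) df.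
  move=> dFy; have : is_derive (y + 0 *: u) u (fun w => F (w + v)) df; last first.
    by rewrite scale0r addr0.
  apply/is_derive_line.
  have -> : (fun s : R => F (y + s *: u + v)) = (fun s => F (y + v + s *: u)).
    by apply/funext => s; rewrite addrAC.
  by apply/is_derive_line; rewrite scale0r addr0.
have dD (s : R) : 0 <= s <= 1 ->
    is_derive (z + s *: u) u D (G (z + s *: u + v) - G (z + s *: u)).
  move=> s01; apply: is_deriveB.
    by apply: shiftv; have [] := dF s 1 s01; rewrite ?ler01 ?lexx // scale1r.
  by have [] := dF s 0 s01; rewrite ?ler01 ?lexx // scale0r addr0.
have [s s01|s s01 DE] := @mean_value_segment _ _ D z u; first by case: (dD s s01).
have [t t01|t t01 tE] := @mean_value_segment _ _ G (z + s *: u) v.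
  by have [_ []] := dF s t s01 t01.
exists s, t; split=> //; have [_ [_ <-]] := dF s t s01 t01; rewrite -tE.
move: DE; case: (dD s s01) => _ -> <-.
by rewrite /D; ring.
Qed.

Lemma close_of_half_close (R : realType) (x y x' y' e : R) :
  `|x - x'| <= e / 2 -> `|y - y'| <= e / 2 -> x' = y' -> `|x - y| <= e.
Proof.
move=> xx' yy' x'y'; rewrite -x'y' in yy'; move: xx' yy'; rewrite !ler_norml.
by move=> /andP[? ?] /andP[? ?]; apply/andP; split; lra.
Qed.

(** Both mixed derivatives, taken at suitable points near z, are equal to the same
second difference quotient, which is symmetric in the two directions. *)
Lemma schwarz (R : realType) d (F : 'rV[R]_d -> R) (z : 'rV[R]_d) (a b : 'I_d) :
  (\forall y \near z, derivable F y 'e_a /\ derivable F y 'e_b) ->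
  (\forall y \near z, derivable (partial F a) y 'e_b /\ derivable (partial F b) y 'e_a) ->
  {for z, continuous (partial (partial F a) b)} ->
  {for z, continuous (partial (partial F b) a)} ->
  partial (partial F a) b z = partial (partial F b) a z.
Proof.
move=> dF ddF cab cba; apply/eqP; rewrite -subr_eq0 -normr_le0.
apply/ler_addgt0Pr => e e0; rewrite add0r.
move/cvgrPdist_le: cab => /(_ (e / 2)); rewrite divr_gt0 // => /(_ isT) cab.
move/cvgrPdist_le: cba => /(_ (e / 2)); rewrite divr_gt0 // => /(_ isT) cba.
have := near_and (near_and dF ddF) (near_and cab cba).
move=> nearz; have [r /= r0 rP] := (@nbhs_ballP _ 'rV[R]_d z _).1 nearz.
(* k is the side of a parallelogram that starts at z and lies in the ball. *)
have [k k0 kr] : exists2 k : R, 0 < k & k + k < r by exists (r / 3); lra.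
have inb c c' (s t : R) : 0 <= s <= 1 -> 0 <= t <= 1 ->
    ball z r (z + s *: (k *: 'e_c) + t *: (k *: 'e_c')).
  move=> /andP[s0 s1] /andP[t0 t1]; apply/mx_ballP; split=> // i.
  rewrite !mxE -addrA opprD addrA subrr sub0r normrN.
  apply: (@le_lt_trans _ _ (k + k)) => //.
  apply: le_trans (ler_normD _ _) _.
  by apply: lerD; rewrite !normrM (gtr0_norm k0) ger0_norm // normr_nat;
    case: (_ && _); rewrite ?mulr1n ?mulr0n ?mulr1 ?mulr0 ?(ltW k0) // ler_piMl // ltW.
have diff2 c c' : (forall y, ball z r y -> derivable F y 'e_c /\ derivable (partial F c) y 'e_c') ->
  exists2 w, ball z r w &
    F (z + k *: 'e_c + k *: 'e_c') - F (z + k *: 'e_c) - F (z + k *: 'e_c') + F z =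
    k * (k * partial (partial F c) c' w).
  move=> dc.
  have [s t s01 t01|s [t [s01 t01 ->]]] := @second_difference R _ F (fun y => k * partial F c y)
      (fun y => k * (k * partial (partial F c) c' y)) z (k *: 'e_c) (k *: 'e_c').
    have [dFy dGy] := dc _ (inb c c' s t s01 t01); split.
      exact: is_derive_scale (derivableP dFy).
    exact: is_derive_scale (is_deriveZ _ (derivableP dGy)).
  by exists (z + s *: (k *: 'e_c) + t *: (k *: 'e_c')); first exact: inb.
have [y /rP[[[? ?] [? ?]] _]|w1 /rP[_ [w1P _]] E1] := diff2 a b; first by [].
have [y /rP[[[? ?] [? ?]] _]|w2 /rP[_ [_ w2P]] E2] := diff2 b a; first by [].
have E : partial (partial F a) b w1 = partial (partial F b) a w2.
  have : k * (k * partial (partial F a) b w1) = k * (k * partial (partial F b) a w2).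
    apply: etrans (esym E1) _; apply: etrans _ E2.
    have -> : z + k *: 'e_a + k *: 'e_b = z + k *: 'e_b + k *: 'e_a by exact: addrAC.
    by congr (_ + _); exact: addrAC.
  by move=> /(mulfI (lt0r_neq0 k0))/(mulfI (lt0r_neq0 k0)).
exact: close_of_half_close w1P w2P E.
Qed.

Lemma is_derive_bsum (R : realType) (V : normedModType R) (I : Type) (r : seq I)
    (h : I -> V -> R) (dh : I -> R) (y v : V) :
  (forall i, is_derive y v (h i) (dh i)) ->
  is_derive y v (fun z => \sum_(i <- r) h i z) (\sum_(i <- r) dh i).
Proof.
move=> dhP; elim: r => [|i r IH].
  rewrite big_nil; have -> : (fun z => \sum_(i <- [::]) h i z) = cst 0.
    by apply/funext => z; rewrite big_nil.
  exact: is_derive_cst.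
rewrite big_cons; have -> : (fun z => \sum_(j <- i :: r) h j z) =
    h i + (fun z => \sum_(j <- r) h j z).
  by apply/funext => z; rewrite big_cons.
exact: is_deriveD.
Qed.

Lemma is_derive_mul (R : realType) (V : normedModType R) (f g : V -> R) (y v : V) (df dg : R) :
  is_derive y v f df -> is_derive y v g dg ->
  is_derive y v (fun z => f z * g z) (df * g y + f y * dg).
Proof.
move=> F G; have H := is_deriveM F G.
by rewrite addrC [df * _]mulrC; exact: H.
Qed.

Section DiffTools.
Variables (R : realType) (V : normedModType R).
Implicit Types F G : V -> R.

(** Needed for functions that agree with a differentiable formula on an open set
only, such as the components of the Sasaki metric. *)
Lemma near_eq_differentiable F G (y : V) :
  (\forall z \near y, F z = G z) -> differentiable F y -> differentiable G y.
Proof.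
move=> FG dF; have FGy := nbhs_singleton FG.
apply: (@differentiable_littleo _ _ _ G ('d F y)).
- by move=> k u v; rewrite linearP.
- exact: diff_continuous.
move=> e e0.
have := diff_locally dF => /eqaddoP /(_ e e0).
have n0 : \forall h \near (0 : V), F (h + y) = G (h + y).
  by move: FG; rewrite (near_shift 0 y) /=; apply: filterS => h /=; rewrite subr0.
move=> H; near=> h.
have E : F (h + y) = G (h + y) by near: h.
rewrite -E -FGy -addrA -opprD.
by have : `|((F \o shift y) - (cst (F y) + 'd F y)) h| <= e * `|h| by near: h.
Unshelve. all: by end_near. Qed.

Lemma differentiable_add F G y : differentiable F y -> differentiable G y ->
  differentiable (fun z => F z + G z) y.
Proof. exact: differentiableD. Qed.

Lemma differentiable_mul F G y : differentiable F y -> differentiable G y ->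
  differentiable (fun z => F z * G z) y.
Proof. exact: differentiableM. Qed.

Lemma differentiable_opp F y : differentiable F y -> differentiable (fun z => - F z) y.
Proof. exact: differentiableN. Qed.

Lemma differentiable_bsum (I : Type) (r : seq I) (F : I -> V -> R) y :
  (forall i, differentiable (F i) y) -> differentiable (fun z => \sum_(i <- r) F i z) y.
Proof.
move=> dF; elim: r => [|i r IH].
  rewrite (_ : (fun z => _) = cst 0); first exact: differentiable_cst.
  by apply/funext => z; rewrite big_nil.
rewrite (_ : (fun z => _) = (fun z => F i z + \sum_(j <- r) F j z)).
  exact: differentiable_add.
by apply/funext => z; rewrite big_cons.
Qed.

Lemma differentiable_bprod (I : Type) (r : seq I) (F : I -> V -> R) y :
  (forall i, differentiable (F i) y) -> differentiable (fun z => \prod_(i <- r) F i z) y.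
Proof.
move=> dF; elim: r => [|i r IH].
  rewrite (_ : (fun z => _) = cst 1); first exact: differentiable_cst.
  by apply/funext => z; rewrite big_nil.
rewrite (_ : (fun z => _) = (fun z => F i z * \prod_(j <- r) F j z)).
  exact: differentiable_mul.
by apply/funext => z; rewrite big_cons.
Qed.

End DiffTools.

Lemma differentiable_base (R : realType) m k (F : 'rV[R]_m -> R) (y : 'rV[R]_(m + k)) :
  differentiable F (lsubmx y) -> differentiable (fun z => F (lsubmx z)) y.
Proof.
move=> dF; apply: (@differentiable_comp _ _ _ _ (lsubmx : 'rV[R]_(m + k) -> 'rV[R]_m) F) => //.
exact: differentiable_lsubmx.
Qed.

Lemma is_derive_base (R : realType) m k (F : 'rV[R]_m -> R) (y v : 'rV[R]_(m + k)) df :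
  is_derive (lsubmx y) (lsubmx v) F df -> is_derive y v (fun z => F (lsubmx z)) df.
Proof.
move=> dF; have : is_derive (y + 0 *: v) v (fun z => F (lsubmx z)) df; last first.
  by rewrite scale0r addr0.
apply/is_derive_line.
rewrite (_ : (fun s : R => _) = (fun s => F (lsubmx y + s *: lsubmx v))); last first.
  by apply/funext => s; rewrite linearD linearZ.
by apply/is_derive_line; rewrite scale0r addr0.
Qed.

(** * Smooth functions on open sets of coordinates *)

Lemma continuous_near_eq (T W : topologicalType) (F G : T -> W) (y : T) :
  (\forall z \near y, F z = G z) -> {for y, continuous F} -> {for y, continuous G}.
Proof.
move=> FG cF; rewrite /prop_for /continuous_at -(nbhs_singleton FG).
by apply: cvg_trans cF; exact: near_eq_cvg.
Qed.

Lemma for_continuousD (R : realType) (T : topologicalType) (F G : T -> R) y :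
  {for y, continuous F} -> {for y, continuous G} -> {for y, continuous (fun z => F z + G z)}.
Proof. exact: (@continuousD _ _ _ F G). Qed.
Lemma for_continuousM (R : realType) (T : topologicalType) (F G : T -> R) y :
  {for y, continuous F} -> {for y, continuous G} -> {for y, continuous (fun z => F z * G z)}.
Proof. exact: (@continuousM _ _ F G). Qed.
Lemma for_continuousV (R : realType) (T : topologicalType) (F : T -> R) y :
  F y != 0 -> {for y, continuous F} -> {for y, continuous (fun z => (F z)^-1)}.
Proof. exact: (@continuousV _ _ F). Qed.

Section CkAlgebra.
Variables (R : realType) (d : nat) (U : set 'rV[R]_d).
Hypothesis oU : open U.
Implicit Types F G : 'rV[R]_d -> R.

Lemma near_open y : U y -> \forall z \near y, U z.
Proof. by move=> Uy; apply: open_nbhs_nbhs. Qed.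

Lemma near_eq_open (T : Type) (F G : 'rV[R]_d -> T) y : U y -> (forall z, U z -> F z = G z) ->
  \forall z \near y, F z = G z.
Proof. by move=> Uy FG; apply: filterS (near_open Uy). Qed.

Lemma Ck_on_ext k F G : (forall y, U y -> F y = G y) -> Ck_on k U F -> Ck_on k U G.
Proof.
elim: k F G => [|k IH] F G FG /= [cF dF]; split.
- by move=> y Uy; exact: continuous_near_eq (near_eq_open Uy FG) (cF y Uy).
- by [].
- by move=> y Uy; exact: continuous_near_eq (near_eq_open Uy FG) (cF y Uy).
- move=> a; have [dFa CFa] := dF a; split=> [y Uy|].
    exact: near_eq_derivable (near_eq_open Uy FG) (dFa y Uy).
  apply: IH CFa => y Uy; exact: near_eq_derive (near_eq_open Uy FG).
Qed.

Lemma Ck_onW k F : Ck_on k.+1 U F -> Ck_on k U F.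
Proof.
elim: k F => [|k IH] F [cF dF]; split=> // a.
by have [dFa CFa] := dF a; split=> //; exact: IH.
Qed.

Lemma Ck_on_cst k (c : R) : Ck_on k U (cst c).
Proof.
elim: k c => [|k IH] c; split=> //; try by move=> y _; exact: cst_continuous.
move=> a; split=> [y _|]; first exact: derivable_cst.
by apply: Ck_on_ext (IH 0) => y _; rewrite /partial derive_cst.
Qed.

Lemma Ck_onD k F G : Ck_on k U F -> Ck_on k U G -> Ck_on k U (fun y => F y + G y).
Proof.
elim: k F G => [|k IH] F G [cF dF] [cG dG]; split=> //;
  try by move=> y Uy; exact: for_continuousD (cF y Uy) (cG y Uy).
move=> a; have [dFa CFa] := dF a; have [dGa CGa] := dG a; split=> [y Uy|].
  by apply: derivableD; [exact: dFa|exact: dGa].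
apply: Ck_on_ext (IH _ _ CFa CGa) => y Uy.
by rewrite /partial; apply/esym/deriveD; [exact: dFa|exact: dGa].
Qed.

Lemma Ck_onM k F G : Ck_on k U F -> Ck_on k U G -> Ck_on k U (fun y => F y * G y).
Proof.
elim: k F G => [|k IH] F G CF CG; have [cF dF] := CF; have [cG dG] := CG; split=> //;
  try by move=> y Uy; exact: for_continuousM (cF y Uy) (cG y Uy).
move=> a; have [dFa CFa] := dF a; have [dGa CGa] := dG a; split=> [y Uy|].
  by apply: derivableM; [exact: dFa|exact: dGa].
apply: Ck_on_ext (Ck_onD (IH _ _ (Ck_onW CF) CGa) (IH _ _ (Ck_onW CG) CFa)) => y Uy.
by rewrite /partial; apply/esym/deriveM; [exact: dFa|exact: dGa].
Qed.

(** The derivative of 1 / F is - F' / F^2, in which 1 / F occurs again; the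
induction on k covers this factor. *)
Lemma Ck_onV k F : (forall y, U y -> F y != 0) -> Ck_on k U F ->
  Ck_on k U (fun y => (F y)^-1).
Proof.
move=> F0; elim: k => [|k IH] CF; have [cF dF] := CF; split=> //;
  try by move=> y Uy; exact: for_continuousV (F0 y Uy) (cF y Uy).
move=> a; have [dFa CFa] := dF a; split=> [y Uy|].
  by apply: derivableV; [exact: F0|exact: dFa].
have CV := IH (Ck_onW CF).
have := Ck_onM (Ck_onM (Ck_on_cst k (-1)) CFa) (Ck_onM CV CV).
apply: Ck_on_ext => y Uy; rewrite /partial.
have := deriveV (F0 y Uy) (dFa y Uy); rewrite /partial => ->.
by rewrite mulN1r expr2 invfM mulNr scaleNr mulrC.
Qed.

End CkAlgebra.

Section SmoothAlgebra.
Variables (R : realType) (d : nat) (U : set 'rV[R]_d).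
Hypothesis oU : open U.
Implicit Types F G : 'rV[R]_d -> R.

Lemma smooth_on_ext F G : (forall y, U y -> F y = G y) -> smooth_on U F -> smooth_on U G.
Proof. by move=> FG sF k; apply: Ck_on_ext (sF k). Qed.

Lemma smooth_on_cst (c : R) : smooth_on U (cst c).
Proof. by move=> k; apply: Ck_on_cst. Qed.

Lemma smooth_onD F G : smooth_on U F -> smooth_on U G -> smooth_on U (fun y => F y + G y).
Proof. by move=> sF sG k; apply: Ck_onD. Qed.

Lemma smooth_onM F G : smooth_on U F -> smooth_on U G -> smooth_on U (fun y => F y * G y).
Proof. by move=> sF sG k; apply: Ck_onM. Qed.

Lemma smooth_onB F G : smooth_on U F -> smooth_on U G -> smooth_on U (fun y => F y - G y).
Proof.
move=> sF sG; apply: smooth_onD => //.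
by apply: smooth_on_ext (smooth_onM (smooth_on_cst (-1)) sG) => y _; rewrite mulN1r.
Qed.

Lemma smooth_onV F : (forall y, U y -> F y != 0) -> smooth_on U F ->
  smooth_on U (fun y => (F y)^-1).
Proof. by move=> F0 sF k; apply: Ck_onV. Qed.

Lemma smooth_on_sum (I : Type) (r : seq I) (P : pred I) (F : I -> 'rV[R]_d -> R) :
  (forall i, P i -> smooth_on U (F i)) -> smooth_on U (fun y => \sum_(i <- r | P i) F i y).
Proof.
move=> sF; elim: r => [|i r IH].
  by apply: smooth_on_ext (smooth_on_cst 0) => y _; rewrite big_nil.
case Pi : (P i); last by apply: smooth_on_ext IH => y _; rewrite big_cons Pi.
by apply: smooth_on_ext (smooth_onD (sF i Pi) IH) => y _; rewrite big_cons Pi.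
Qed.

Lemma smooth_on_prod (I : Type) (r : seq I) (P : pred I) (F : I -> 'rV[R]_d -> R) :
  (forall i, P i -> smooth_on U (F i)) -> smooth_on U (fun y => \prod_(i <- r | P i) F i y).
Proof.
move=> sF; elim: r => [|i r IH].
  by apply: smooth_on_ext (smooth_on_cst 1) => y _; rewrite big_nil.
case Pi : (P i); last by apply: smooth_on_ext IH => y _; rewrite big_cons Pi.
by apply: smooth_on_ext (smooth_onM (sF i Pi) IH) => y _; rewrite big_cons Pi.
Qed.

Lemma smooth_on_det m (A : 'rV[R]_d -> 'M[R]_m) :
  (forall i j, smooth_on U (fun y => A y i j)) -> smooth_on U (fun y => \det (A y)).
Proof.
move=> sA; apply: smooth_on_sum => s _; apply: smooth_onM; first exact: smooth_on_cst.
by apply: smooth_on_prod => i _; exact: sA.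
Qed.

(** By Cramer's rule the entries of the inverse are quotients of determinants. *)
Lemma smooth_on_invmx m (A : 'rV[R]_d -> 'M[R]_m) i j :
  (forall y, U y -> A y \in unitmx) ->
  (forall i j, smooth_on U (fun y => A y i j)) -> smooth_on U (fun y => invmx (A y) i j).
Proof.
move=> uA sA; apply: (@smooth_on_ext (fun y => (\det (A y))^-1 *
    ((-1) ^+ (j + i) * \det (row' j (col' i (A y)))))).
  by move=> y Uy; rewrite /invmx uA // !mxE.
apply: smooth_onM.
  apply: smooth_onV (smooth_on_det sA) => y Uy.
  by rewrite -unitfE -unitmxE uA.
apply: smooth_onM; first exact: smooth_on_cst.
apply: smooth_on_det => a b; apply: smooth_on_ext (sA (lift j a) (lift i b)) => y _.
by rewrite !mxE.
Qed.

Lemma smooth_on_partial F a : smooth_on U F -> smooth_on U (partial F a).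
Proof. by move=> sF k; have [_ /(_ a)[]] := sF k.+1. Qed.

Lemma smooth_on_derivable F a y : smooth_on U F -> U y -> derivable F y 'e_a.
Proof. by move=> sF Uy; have [_ /(_ a)[dF _]] := sF 1; exact: dF. Qed.

Lemma smooth_on_continuous F y : smooth_on U F -> U y -> {for y, continuous F}.
Proof. by move=> sF Uy; have [cF _] := sF 0; exact: cF. Qed.

Lemma smooth_on_differentiable F y : smooth_on U F -> U y -> differentiable F y.
Proof.
move=> sF Uy; apply: differentiable_of_C1.
  by apply: filterS (near_open oU Uy) => z Uz a; exact: smooth_on_derivable.
by move=> a; apply: smooth_on_continuous (smooth_on_partial a sF) Uy.
Qed.

Lemma smooth_on_schwarz F a b y : smooth_on U F -> U y ->
  partial (partial F a) b y = partial (partial F b) a y.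
Proof.
move=> sF Uy.
have sp c : smooth_on U (partial F c) by exact: smooth_on_partial.
apply: schwarz.
- by apply: filterS (near_open oU Uy) => z Uz; split; exact: smooth_on_derivable.
- by apply: filterS (near_open oU Uy) => z Uz; split; apply: smooth_on_derivable (sp _) Uz.
- exact: smooth_on_continuous (smooth_on_partial _ (sp _)) Uy.
- exact: smooth_on_continuous (smooth_on_partial _ (sp _)) Uy.
Qed.

End SmoothAlgebra.

(** * Repeatedly differentiable functions of one variable *)

(** The one-variable analogue of Ck_on. The derivatives are peeled off from the
inside, so that products and compositions are handled by induction on k. *)
Fixpoint Dk_on (R : realType) (k : nat) (J : set R) (c : R -> R) : Prop :=
  if k is k'.+1 then (forall t, J t -> derivable c t 1) /\ Dk_on k' J (derive1 c) else True.

Section IteratedDerivatives.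
Variables (R : realType) (J : set R).
Hypothesis oJ : open J.
Implicit Types c e : R -> R.

Lemma Dk_onP c : (forall k t, J t -> derivable (derive1n k c) t 1) <-> forall k, Dk_on k J c.
Proof.
split=> [H k|H k].
  elim: k c H => [//|k IH] c H; split=> [t Jt|]; first exact: (H 0 t Jt).
  by apply: IH => j t Jt; rewrite -derive1Sn; exact: H.
elim: k c H => [|k IH] c H t Jt; first by have [+ _] := H 1; exact.
by rewrite derive1Sn; apply: IH => // j; have [] := H j.+1.
Qed.

Lemma near_eq_openR (T : Type) (f g : R -> T) t : J t -> (forall s, J s -> f s = g s) ->
  \forall s \near t, f s = g s.
Proof. by move=> Jt fg; apply: filterS (open_nbhs_nbhs (conj oJ Jt)). Qed.

Lemma Dk_on_ext k c e : (forall t, J t -> c t = e t) -> Dk_on k J c -> Dk_on k J e.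
Proof.
elim: k c e => [//|k IH] c e ce [dc Dc]; split=> [t Jt|].
  exact: near_eq_derivable (near_eq_openR Jt ce) (dc t Jt).
apply: IH Dc => t Jt; rewrite !derive1E; exact: near_eq_derive (near_eq_openR Jt ce).
Qed.

Lemma Dk_onW k c : Dk_on k.+1 J c -> Dk_on k J c.
Proof. by elim: k c => [//|k IH] c [dc Dc]; split=> //; exact: IH. Qed.

Lemma Dk_on_cst k (a : R) : Dk_on k J (cst a).
Proof.
elim: k a => [//|k IH] a; split=> [t _|]; first exact: derivable_cst.
by apply: Dk_on_ext (IH 0) => t _; rewrite derive1_cst.
Qed.

Lemma Dk_onD k c e : Dk_on k J c -> Dk_on k J e -> Dk_on k J (fun t => c t + e t).
Proof.
elim: k c e => [//|k IH] c e [dc Dc] [de De]; split=> [t Jt|].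
  by apply: derivableD; [exact: dc|exact: de].
apply: Dk_on_ext (IH _ _ Dc De) => t Jt; rewrite !derive1E.
by apply/esym/deriveD; [exact: dc|exact: de].
Qed.

Lemma Dk_onM k c e : Dk_on k J c -> Dk_on k J e -> Dk_on k J (fun t => c t * e t).
Proof.
elim: k c e => [//|k IH] c e Dc De; have [dc Dc'] := Dc; have [de De'] := De.
split=> [t Jt|].
  by apply: derivableM; [exact: dc|exact: de].
apply: Dk_on_ext (Dk_onD (IH _ _ (Dk_onW Dc) De') (IH _ _ (Dk_onW De) Dc')) => t Jt.
by rewrite !derive1E; apply/esym/deriveM; [exact: dc|exact: de].
Qed.

Lemma Dk_on_sum k (I : Type) (r : seq I) (c : I -> R -> R) :
  (forall i, Dk_on k J (c i)) -> Dk_on k J (fun t => \sum_(i <- r) c i t).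
Proof.
move=> Dc; elim: r => [|i r IH].
  by apply: Dk_on_ext (Dk_on_cst k 0) => t _; rewrite big_nil.
by apply: Dk_on_ext (Dk_onD (Dc i) IH) => t _; rewrite big_cons.
Qed.

(** The derivative of F o x is the sum of the products of the x_a' with the
(partial F a) o x; the induction runs over all smooth F at once. *)
Lemma Dk_on_comp k d (U : set 'rV[R]_d) (F : 'rV[R]_d -> R) (x : R -> 'rV[R]_d) :
  open U -> smooth_on U F -> (forall t, J t -> U (x t)) ->
  (forall a, Dk_on k J (fun t => x t 0 a)) -> Dk_on k J (F \o x).
Proof.
move=> oU; elim: k F => [//|k IH] F sF xU Dx.
have dFx t : J t -> is_derive t 1 (F \o x)
    (\sum_a (\row_a derive1 (fun s => x s 0 a) t) 0 a * partial F a (x t)).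
  move=> Jt; apply: is_derive_curve => [|a].
    exact (@smooth_on_differentiable _ _ U oU F (x t) sF (xU t Jt)).
  by rewrite mxE derive1E; apply: derivableP; have [+ _] := Dx a; exact.
split=> [t Jt|]; first by case: (dFx t Jt).
apply: (@Dk_on_ext _ (fun t => \sum_a derive1 (fun s => x s 0 a) t * (partial F a \o x) t)).
  move=> t Jt; rewrite derive1E; have [_ ->] := dFx t Jt.
  by apply: eq_bigr => a _; rewrite mxE.
apply: Dk_on_sum => a; apply: Dk_onM; first by have [] := Dx a.
apply: IH => //; first exact: smooth_on_partial.
by move=> b; apply: Dk_onW.
Qed.

End IteratedDerivatives.

Lemma Dk_onS (R : realType) k (J J' : set R) c : J' `<=` J -> Dk_on k J c -> Dk_on k J' c.
Proof.
move=> JJ; elim: k c => [//|k IH] c [dc Dc]; split; last exact: IH.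
by move=> t /JJ; exact: dc.
Qed.

(** * Locally Lipschitz maps *)

(** A Lipschitz condition on one ball, with both the radius and the constant made
explicit as the contraction argument needs them. *)
Definition lip_ball (R : realType) d (V : normedModType R) (z : 'rV[R]_d) (r L : R) (F : 'rV[R]_d -> V) :=
  forall u w, ball z r u -> ball z r w -> `|F u - F w| <= L * `|u - w|.

(** Stated for all small radii rather than for one, so that finitely many
conditions can be combined without choosing a common radius. *)
Definition loc_lip (R : realType) d (V : normedModType R) (z : 'rV[R]_d) (F : 'rV[R]_d -> V) :=
  exists L, \forall r \near 0^'+, lip_ball z r L F.

Section LocLip.
Variables (R : realType) (d : nat) (z : 'rV[R]_d).
Implicit Types F G : 'rV[R]_d -> R.

Lemma lip_ballW (V : normedModType R) (F : 'rV[R]_d -> V) r r' L L' :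
  r' <= r -> L <= L' -> lip_ball z r L F -> lip_ball z r' L' F.
Proof.
move=> rr LL lF u w zu zw; apply: le_trans (_ : L * `|u - w| <= _).
  by apply: lF; apply: le_ball rr _ _.
by apply: ler_wpM2r.
Qed.

Lemma loc_lip_ex (V : normedModType R) (F : 'rV[R]_d -> V) r L :
  0 < r -> lip_ball z r L F -> loc_lip z F.
Proof.
move=> r0 lF; exists L; near=> s; apply: lip_ballW lF => //.
by near: s; exact: nbhs_right_le.
Unshelve. all: by end_near. Qed.

Lemma loc_lip_cst (c : R) : loc_lip z (cst c).
Proof.
by apply: (@loc_lip_ex _ _ 1 0) => // u w _ _; rewrite subrr normr0 mul0r.
Qed.

Lemma loc_lipD F G : loc_lip z F -> loc_lip z G -> loc_lip z (fun y => F y + G y).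
Proof.
move=> [L lF] [K lG]; exists (L + K); near=> r => u w zu zw.
rewrite opprD addrACA mulrDl; apply: le_trans (ler_normD _ _) _; apply: lerD.
  by move: zu zw; move: u w; near: r.
by move: zu zw; move: u w; near: r.
Unshelve. all: by end_near. Qed.

Lemma loc_lip_bounded F : loc_lip z F ->
  exists C, \forall r \near 0^'+, forall u, ball z r u -> `|F u| <= C.
Proof.
move=> [L lF]; exists (`|L| + `|F z|); near=> r => u zu.
have r0 : 0 < r by near: r; exact: nbhs_right_gt.
have -> : F u = (F u - F z) + F z by rewrite subrK.
apply: le_trans (ler_normD _ _) _; apply: lerD => //.
have lFr : lip_ball z r L F by near: r.
apply: le_trans (lFr u z zu (ballxx z r0)) _.
apply: (@le_trans _ _ (`|L| * `|u - z|)); first by rewrite ler_wpM2r // ler_norm.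
rewrite ler_piMr //; move: zu; rewrite -ball_normE /= distrC => zu.
by apply: le_trans (ltW zu) _; near: r; exact: nbhs_right_le.
Unshelve. all: by end_near. Qed.

(** From F u G u - F w G w = F u (G u - G w) + G w (F u - F w), both functions being
bounded near z. *)
Lemma loc_lipM F G : loc_lip z F -> loc_lip z G -> loc_lip z (fun y => F y * G y).
Proof.
move=> lF lG; have [C bF] := loc_lip_bounded lF; have [E bG] := loc_lip_bounded lG.
move: lF lG => [L lF] [K lG]; exists (`|C| * `|K| + `|E| * `|L|); near=> r => u w zu zw.
have -> : F u * G u - F w * G w = F u * (G u - G w) + G w * (F u - F w) by ring.
rewrite mulrDl; apply: le_trans (ler_normD _ _) _; rewrite !normrM -!mulrA.
have lFr : lip_ball z r L F by near: r.
have lGr : lip_ball z r K G by near: r.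
have bFr : forall u, ball z r u -> `|F u| <= C by near: r.
have bGr : forall u, ball z r u -> `|G u| <= E by near: r.
apply: lerD; apply: ler_pM => //.
- exact: le_trans (bFr u zu) (ler_norm _).
- by apply: le_trans (lGr u w zu zw) _; rewrite ler_wpM2r // ler_norm.
- exact: le_trans (bGr w zw) (ler_norm _).
- by apply: le_trans (lFr u w zu zw) _; rewrite ler_wpM2r // ler_norm.
Unshelve. all: by end_near. Qed.

Lemma loc_lip_sum (I : Type) (r : seq I) (F : I -> 'rV[R]_d -> R) :
  (forall i, loc_lip z (F i)) -> loc_lip z (fun y => \sum_(i <- r) F i y).
Proof.
move=> lF; elim: r => [|i r IH].
  rewrite (_ : (fun y => _) = cst 0); first exact: loc_lip_cst.
  by apply/funext => y; rewrite big_nil.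
rewrite (_ : (fun y => _) = (fun y => F i y + \sum_(j <- r) F j y)); first exact: loc_lipD.
by apply/funext => y; rewrite big_cons.
Qed.

Lemma loc_lip_coord a : loc_lip z (fun y => y 0 a).
Proof.
apply: (@loc_lip_ex _ _ 1 1) => // u w _ _; rewrite mul1r.
by apply: le_trans (coord_le_norm _ a); rewrite !mxE.
Qed.

Lemma loc_lip_row m (F : 'rV[R]_d -> 'rV[R]_m) :
  (forall a, loc_lip z (fun y => F y 0 a)) -> loc_lip z F.
Proof.
move=> /choice[L lF]; exists (\sum_a `|L a|); near=> r => u w zu zw.
have S0 : 0 <= \sum_a `|L a| by rewrite sumr_ge0.
apply: norm_le_coord => [|a]; first by rewrite mulr_ge0.
rewrite !mxE; apply: le_trans (_ : L a * `|u - w| <= _).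
  have lFr : forall a, lip_ball z r (L a) (fun y => F y 0 a).
    by near: r; apply: filter_forall => b; exact: lF.
  exact: lFr.
rewrite ler_wpM2r // (le_trans (ler_norm _)) // (bigD1 a) //= lerDl sumr_ge0 //.
Unshelve. all: by end_near. Qed.

End LocLip.

Lemma norm_lsubmx (R : realType) m n (w : 'rV[R]_(m + n)) : `|lsubmx w| <= `|w|.
Proof. by apply: norm_le_coord => // a; rewrite mxE; exact: coord_le_norm. Qed.

Lemma loc_lip_lsubmx (R : realType) m n (F : 'rV[R]_m -> R) (z : 'rV[R]_(m + n)) :
  loc_lip (lsubmx z) F -> loc_lip z (fun w => F (lsubmx w)).
Proof.
move=> [L lF]; exists `|L|; near=> r => u w zu zw.
have lFr : lip_ball (lsubmx z) r L F by near: r.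
have bl y : ball z r y -> ball (lsubmx z) r (lsubmx y).
  rewrite -!ball_normE /=; apply: le_lt_trans.
  by rewrite -linearB; exact: norm_lsubmx.
apply: le_trans (lFr _ _ (bl _ zu) (bl _ zw)) _.
apply: (@le_trans _ _ (`|L| * `|lsubmx u - lsubmx w|)); first by rewrite ler_wpM2r // ler_norm.
by rewrite ler_wpM2l // -linearB; exact: norm_lsubmx.
Unshelve. all: by end_near. Qed.

(** The partial derivatives are bounded near z by continuity, and the mean value
theorem turns this bound into a Lipschitz constant. *)
Lemma loc_lip_of_C1 (R : realType) d (F : 'rV[R]_d -> R) (z : 'rV[R]_d) :
  (\forall y \near z, forall a, derivable F y 'e_a) ->
  (forall a, {for z, continuous (partial F a)}) ->
  loc_lip z F.
Proof.
move=> dF cF; pose c a := partial F a z.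
have near_c : \forall y \near z, forall a, `|partial F a y| <= \sum_b `|c b| + 1.
  apply: near_all => a; move/cvgrPdist_le: (cF a) => /(_ 1 ltr01).
  apply: filterS => y; rewrite distrC => yc.
  have -> : partial F a y = (partial F a y - c a) + c a by rewrite subrK.
  apply: le_trans (ler_normD _ _) _; rewrite addrC lerD //.
  by rewrite (bigD1 a) //= lerDl sumr_ge0.
have /nbhs_ballP[r /= r0 rP] : \forall y \near z,
      (forall a, derivable F y 'e_a) /\ (forall a, `|partial F a y| <= \sum_b `|c b| + 1).
    by apply: filterI.
apply: (@loc_lip_ex _ _ _ _ _ r (d%:R * (\sum_b `|c b| + 1))) => // u w zu zw.
have [|xi xib ->] := @mean_value_coords _ _ F z _ _ r _ zw zu.
  by move=> y /rP[].
under eq_bigr => a _.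
  have -> : u 0 a - w 0 a = (u - w) 0 a by rewrite !mxE.
  over.
by apply: norm_sum_coord => a; have [_] := rP _ (xib a); apply.
Qed.

Lemma smooth_on_lip (R : realType) d (U : set 'rV[R]_d) (F : 'rV[R]_d -> R) y :
  open U -> smooth_on U F -> U y ->
  loc_lip y F.
Proof.
move=> oU sF Uy; apply: loc_lip_of_C1.
  by apply: filterS (near_open oU Uy) => z Uz a; exact (smooth_on_derivable sF Uz).
by move=> a; apply: smooth_on_continuous (smooth_on_partial a sF) Uy.
Qed.

(** * Existence of solutions of ordinary differential equations *)

Lemma half_pow_small (R : realType) (C e : R) : 0 < e -> exists j, C / 2 ^+ j < e.
Proof.
move=> e0; have C0 : 0 <= `|C| / e by rewrite divr_ge0 // ltW.
exists (Num.bound (`|C| / e)); set j := Num.bound _.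
rewrite ltr_pdivrMr ?exprn_gt0 // mulrC -ltr_pdivrMr //.
apply: (@le_lt_trans _ _ (`|C| / e)); first by rewrite ler_pM2r ?invr_gt0 // ler_norm.
apply: lt_trans (archi_boundP C0) _.
by rewrite -natrX ltr_nat ltn_expl.
Qed.

Lemma half_pow_eq0 (R : realType) (V : normedModType R) (v : V) (C : R) :
  (forall j, `|v| <= C / 2 ^+ j) -> v = 0.
Proof.
move=> vC; apply/eqP; rewrite -normr_eq0 eq_le normr_ge0 andbT.
apply/ler_addgt0Pr => e e0; rewrite add0r.
by have [j je] := half_pow_small C e0; exact: le_trans (vC j) (ltW je).
Qed.

Lemma geometric_limit (R : realType) (a : nat -> R) (C : R) :
  (forall j k, `|a (j + k)%N - a j| <= C / 2 ^+ j) ->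
  exists l, forall j, `|l - a j| <= C / 2 ^+ j.
Proof.
move=> aC.
have ca : cvg (a @ \oo).
  apply: cauchy_cvg; apply: cauchy_exP => e e0.
  have [j je] := half_pow_small C e0; exists (a j).
  exists j => // k /= jk; rewrite -ball_normE /= distrC -(subnKC jk).
  exact: le_lt_trans (aC _ _) je.
exists (lim (a @ \oo)) => j; apply/ler_addgt0Pr => e e0.
move/cvgrPdist_le: (ca : a @ \oo --> lim (a @ \oo)) => /(_ e e0)[N _ aN].
have /= := aN (N + j)%N (leq_addr _ _) => aNj.
have -> : lim (a @ \oo) - a j = (a (j + N)%N - a j) + (lim (a @ \oo) - a (N + j)%N).
  by rewrite addnC [RHS]addrC addrA subrK.
by apply: le_trans (ler_normD _ _) _; rewrite lerD.
Qed.

Lemma geometric_limit_row (R : realType) m (a : nat -> 'rV[R]_m) (C : R) :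
  (forall j k, `|a (j + k)%N - a j| <= C / 2 ^+ j) ->
  exists l : 'rV[R]_m, forall j, `|l - a j| <= C / 2 ^+ j.
Proof.
move=> aC; have /choice[l lP] (i : 'I_m) :
    exists l, forall j, `|l - a j 0 i| <= C / 2 ^+ j.
  apply: geometric_limit => j k; apply: le_trans (aC j k).
  by apply: le_trans (coord_le_norm _ i); rewrite !mxE.
exists (\row_i l i) => j; apply: norm_le_coord => [|i]; last by rewrite !mxE.
by apply: le_trans (aC j 0%N).
Qed.

(** Integrating from - T, rather than from 0, gives one formula for the
antiderivative on both sides of 0. *)
Definition primitive (R : realType) (T : R) (h : R -> R) (t : R) : R :=
  (\int[lebesgue_measure]_(s in `[- T, t]) h s) -
  (\int[lebesgue_measure]_(s in `[- T, 0]) h s).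

Lemma primitive0 (R : realType) (T : R) (h : R -> R) : primitive T h 0 = 0.
Proof. exact: subrr. Qed.

Lemma is_derive_primitive (R : realType) (T : R) (h : R -> R) (t : R) :
  continuous h -> `|t| < T -> is_derive t 1 (primitive T h) (h t).
Proof.
move=> ch; rewrite ltr_norml => /andP[Tt tT].
have ih : lebesgue_measure.-integrable `[- T, T] (EFin \o h).
  apply: continuous_compact_integrable; first exact: segment_compact.
  exact: continuous_subspaceT.
have := continuous_FTC1_closed tT ih Tt (ch t).
set I := (fun x => _) => /= -[dI It].
have dh : is_derive t 1 I (h t).
  by apply: DeriveDef; [exact: dI|rewrite -derive1E].
have := is_deriveB dh (is_derive_cst (\int[lebesgue_measure]_(s in `[- T, 0]) h s) t 1).
by rewrite subr0.
Qed.

(** The mean value theorem for the difference of the two antiderivatives, which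
vanishes at 0 and has derivative h1 - h2. *)
Lemma primitive_le (R : realType) (T b : R) (h1 h2 : R -> R) (D t : R) :
  continuous h1 -> continuous h2 -> b < T -> (forall s, `|s| <= b -> `|h1 s - h2 s| <= D) ->
  `|t| <= b -> `|primitive T h1 t - primitive T h2 t| <= D * b.
Proof.
move=> c1 c2 bT hD tb; have b0 : 0 <= b by exact: le_trans tb.
have D0 : 0 <= D by apply: le_trans (hD 0 _); rewrite ?normr0.
pose F s := primitive T h1 s - primitive T h2 s.
have inb (s : R) : 0 <= s <= 1 -> `|s * t| <= b.
  move=> /andP[s0 s1]; rewrite normrM (ger0_norm s0).
  by apply: le_trans tb; rewrite ler_piMl.
have dF (s : R) : 0 <= s <= 1 -> is_derive (0 + s *: t) t F (t * (h1 (s * t) - h2 (s * t))).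
  move=> s01; rewrite add0r.
  have -> : t = t *: (1 : R) by rewrite [t *: 1]mulr1.
  have sT : `|s *: (t *: (1 : R))| < T.
    by rewrite [t *: 1]mulr1; exact: le_lt_trans (inb s s01) bT.
  have := is_derive_scale t (is_deriveB (is_derive_primitive c1 sT) (is_derive_primitive c2 sT)).
  by rewrite [t *: 1]mulr1.
have [s s01|s s01] := @mean_value_segment _ _ F 0 t; first by case: (dF s s01).
have [_ ->] := dF s s01; rewrite add0r /F !primitive0 subrr subr0 => ->.
rewrite normrM mulrC; apply: ler_pM => //; apply: hD; exact: inb.
Qed.

(** Picard iteration on [-T, T]. The smallness conditions on T make the integral
operator a contraction of factor 1/2 that preserves the curves staying within
r / 2 of u0. *)
Section Picard.
Variables (R : realType) (m : nat) (F : 'rV[R]_m -> 'rV[R]_m) (u0 : 'rV[R]_m) (r L T : R).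
Hypotheses (r0 : 0 < r) (lipF : lip_ball u0 r L F) (T0 : 0 < T).
Hypotheses (LT : L * T <= 2^-1) (FT : `|F u0| * T <= r / 4).

(* Curves are controlled on [-T, T] only. Precomposition with clip extends them
continuously to the line, where they can be integrated. *)
Let clip (t : R) : R := Num.max (- T) (Num.min T t).

Let clip_le t : `|clip t| <= T.
Proof.
have TT : - T <= T by rewrite ge0_cp // ltW.
by rewrite ler_norml /clip le_max lexx ge_max TT /= ge_min lexx.
Qed.

Let clipE t : `|t| <= T -> clip t = t.
Proof. by rewrite ler_norml /clip => /andP[Tt tT]; rewrite min_r // max_r. Qed.

Let clip_cont : continuous clip.
Proof.
move=> t; apply: (@continuous_max _ _ (cst (- T)) (fun t => Num.min T t)).
  exact: cst_continuous.
by apply: (@continuous_min _ _ (cst T) id); [exact: cst_continuous|].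
Qed.

Let good (u : R -> 'rV[R]_m) :=
  continuous (u \o clip) /\ forall t, `|t| <= T -> `|u t - u0| <= r / 2.

Let goodb u t : good u -> `|t| <= T -> ball u0 r (u t).
Proof.
move=> [_ gu] tT; rewrite -ball_normE /= distrC.
by apply: le_lt_trans (gu t tT) _; rewrite ltr_pdivrMr // ltr_pMr // ltr1n.
Qed.

Let rhs (u : R -> 'rV[R]_m) (a : 'I_m) (s : R) := F (u (clip s)) 0 a.

Let rhs_cont u : good u -> forall a, continuous (rhs u a).
Proof.
move=> gu a t; apply/cvgrPdist_le => e e0.
have ut := goodb gu (clip_le t).
pose L' := Num.max 1 L.
have L'0 : 0 < L' by rewrite lt_max ltr01.
have [cu _] := gu; move/cvgrPdist_le: (cu t) => /(_ (e / L')).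
rewrite divr_gt0 // => /(_ isT); apply: filterS => s us.
apply: le_trans (_ : `|F (u (clip t)) - F (u (clip s))| <= _).
  by apply: le_trans (coord_le_norm _ a); rewrite !mxE.
apply: le_trans (lipF ut (goodb gu (clip_le s))) _.
apply: (@le_trans _ _ (L' * `|u (clip t) - u (clip s)|)).
  by rewrite ler_wpM2r // le_max lexx orbT.
by rewrite mulrC -ler_pdivlMr.
Qed.

(* The antiderivative on ]- 2 T, 2 T[ is differentiable at the end points of
[- T, T] too. *)
Let Phi (u : R -> 'rV[R]_m) (t : R) : 'rV[R]_m :=
  u0 + \row_a primitive (2 * T) (rhs u a) t.

Let T2 : T < 2 * T. Proof. by rewrite ltr_pMl // ltr1n. Qed.

Let Phi_derive u (t : R) a : good u -> `|t| < 2 * T ->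
  is_derive t 1 (fun s => Phi u s 0 a) (F (u (clip t)) 0 a).
Proof.
move=> gu tT.
have -> : (fun s => Phi u s 0 a) = cst (u0 0 a) + primitive (2 * T) (rhs u a).
  by apply/funext => s; rewrite /Phi !mxE.
have := is_deriveD (is_derive_cst (u0 0 a) t 1) (is_derive_primitive (@rhs_cont u gu a) tT).
by rewrite add0r.
Qed.

Let Phi_contract u w D : good u -> good w ->
  (forall t, `|t| <= T -> `|u t - w t| <= D) ->
  forall t, `|t| <= T -> `|Phi u t - Phi w t| <= D / 2.
Proof.
move=> gu gw uwD t tT.
have D0 : 0 <= D by apply: le_trans (uwD t tT).
pose L' := Num.max 0 L.
apply: (@le_trans _ _ (L' * D * T)); last first.
  rewrite mulrAC mulrC; apply: ler_wpM2l => //.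
  by rewrite /L' /Num.max; case: ifP => // _; rewrite mul0r invr_ge0.
have L'0 : 0 <= L' by rewrite le_max lexx.
apply: norm_le_coord => [|a]; first by rewrite !mulr_ge0 // ltW.
rewrite /Phi !mxE opprD addrACA subrr add0r.
apply: (primitive_le (@rhs_cont _ gu a) (@rhs_cont _ gw a) T2 _ tT).
move=> s sT; rewrite /rhs clipE //.
apply: le_trans (_ : `|F (u s) - F (w s)| <= _).
  by apply: le_trans (coord_le_norm _ a); rewrite !mxE.
apply: le_trans (lipF (goodb gu sT) (goodb gw sT)) _.
apply: (@le_trans _ _ (L' * `|u s - w s|)).
  by rewrite ler_wpM2r // le_max lexx orbT.
by rewrite ler_wpM2l // uwD.
Qed.

Let good0 : good (cst u0).
Proof.
split=> [|t _]; first by move=> t; exact: cst_continuous.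
by rewrite subrr normr0 divr_ge0 // ltW.
Qed.

Let Phi0 t : `|t| <= T -> `|Phi (cst u0) t - u0| <= r / 4.
Proof.
move=> tT; apply: norm_le_coord => [|a]; first by rewrite divr_ge0 // ltW.
rewrite /Phi !mxE addrAC subrr add0r.
have c0 : continuous (cst (0 : R) : R -> R) by move=> s; exact: cst_continuous.
have := @primitive_le R (2 * T) T (rhs (cst u0) a) (cst 0) `|F u0| t _ c0 T2 _ tT.
have -> : primitive (2 * T) (cst 0) t = 0.
  rewrite /primitive /Rintegral.
  by under eq_integral do rewrite /=; rewrite !integral0_eq // subrr.
rewrite subr0 => H; apply: le_trans FT; apply: H; first exact: (@rhs_cont _ good0 a).
by move=> s _; rewrite subr0; exact: coord_le_norm.
Qed.

Let good_Phi u : good u -> good (Phi u).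
Proof.
move=> gu; split=> [t|t tT].
  apply: (@continuous_comp _ _ _ clip (Phi u)); first exact: clip_cont.
  apply: differentiable_continuous; apply/derivable1_diffP.
  apply/derivable_mxP => i a; rewrite ord1.
  by have [] := @Phi_derive u (clip t) a gu (le_lt_trans (clip_le t) T2).
have -> : Phi u t - u0 = (Phi u t - Phi (cst u0) t) + (Phi (cst u0) t - u0).
  by rewrite addrA subrK.
apply: le_trans (ler_normD _ _) _.
(* r / 4 from the contraction and r / 4 from the first step. *)
have := @Phi_contract u (cst u0) (r / 2) gu good0 (proj2 gu) t tT.
by have := Phi0 tT; lra.
Qed.

Let it k := iter k Phi (cst u0).

Let good_it k : good (it k).
Proof. by elim: k => [|k IH]; [exact: good0|exact: good_Phi]. Qed.

Let it_cauchy j k t : `|t| <= T -> `|it (j + k)%N t - it j t| <= (r / 2) / 2 ^+ j.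
Proof.
elim: j t => [|j IH] t tT; first by rewrite expr0 divr1; exact: (proj2 (good_it k)).
rewrite exprSr invfM mulrA; apply: Phi_contract => //; exact: good_it.
Qed.

(** By contraction the iterates it j converge uniformly on [- T, T], at the rate of
2 ^- j, and their limit is a fixed point of the integral operator Phi. *)
Lemma picard_fixpoint : exists u : R -> 'rV[R]_m, u 0 = u0 /\
  forall t, `|t| < T -> ball u0 r (u t) /\
    forall a, is_derive t 1 (fun s => u s 0 a) (F (u t) 0 a).
Proof.
have lim_it t : exists l : 'rV[R]_m, forall j, `|l - it j (clip t)| <= (r / 2) / 2 ^+ j.
  have [l lP] := geometric_limit_row (fun j k => it_cauchy j k (clip_le t)).
  by exists l.
have [x xP] := choice lim_it.
have xit j t : `|t| <= T -> `|x t - it j t| <= (r / 2) / 2 ^+ j.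
  by move=> tT; have := xP t j; rewrite clipE.
have gx : good x.
  split=> [t|t tT]; last by have := xit 0 t tT; rewrite expr0 divr1.
  apply/cvgrPdist_le => e e0.
  have e4 : 0 < e / 4 by rewrite divr_gt0.
  have [j je] := half_pow_small (r / 2) e4.
  have [cj _] := good_it j; move/cvgrPdist_le: (cj t) => /(_ (e / 4) e4).
  apply: filterS => s /= ts.
  have -> : x (clip t) - x (clip s) = (x (clip t) - it j (clip t)) +
      (it j (clip t) - it j (clip s)) - (x (clip s) - it j (clip s)).
    by rewrite addrA subrK opprB addrA subrK.
  apply: le_trans (ler_normB _ _) _.
  have := ler_normD (x (clip t) - it j (clip t)) (it j (clip t) - it j (clip s)).
  have := xit j _ (clip_le t); have := xit j _ (clip_le s); lra.
(* Both Phi x and x are within a multiple of 2 ^- j of the iterate j.+1. *)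
have fix_x t : `|t| <= T -> Phi x t = x t.
  move=> tT; apply/eqP; rewrite -subr_eq0; apply/eqP.
  apply: (@half_pow_eq0 _ _ _ (r / 2)) => j.
  have -> : Phi x t - x t = (Phi x t - it j.+1 t) - (x t - it j.+1 t).
    by rewrite opprB addrA subrK.
  apply: le_trans (ler_normB _ _) _.
  have H1 := @Phi_contract x (it j) _ gx (good_it j) (fun s => @xit j s) t tT.
  have H2 := xit j.+1 t tT; move: H2; rewrite exprSr invfM mulrA => H2.
  have : `|Phi x t - it j.+1 t| <= r / 2 / 2 ^+ j / 2 by exact: H1.
  lra.
(* Phi x is preferred to x, as it is differentiable by construction. *)
exists (Phi x); split=> [|t tT].
  by apply/rowP => a; rewrite /Phi !mxE primitive0 addr0.
have tT' := ltW tT; rewrite fix_x //; split; first exact: goodb.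
move=> a; have := @Phi_derive x t a gx (lt_trans tT T2).
by rewrite clipE.
Qed.

End Picard.

(** T is chosen so that L T <= 1/2 and |F u0| T <= r / 4. *)
Lemma ode_exists (R : realType) (m : nat) (F : 'rV[R]_m -> 'rV[R]_m) (u0 : 'rV[R]_m) (r L : R) :
  0 < r -> lip_ball u0 r L F ->
  exists2 T : R, 0 < T & exists u : R -> 'rV[R]_m, u 0 = u0 /\
  forall t, `|t| < T -> ball u0 r (u t) /\
    forall a, is_derive t 1 (fun s => u s 0 a) (F (u t) 0 a).
Proof.
move=> r0 lipF.
pose K := `|F u0| + 1; pose L' := `|L| + 1.
have K0 : 0 < K by rewrite ltr_wpDl.
have L'0 : 0 < L' by rewrite ltr_wpDl.
pose T := Num.min (r / 4 / K) (2^-1 / L').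
have T0 : 0 < T by rewrite lt_min !divr_gt0.
exists T => //; apply: (picard_fixpoint r0 lipF T0).
  apply: (@le_trans _ _ (L' * T)); last by rewrite mulrC -ler_pdivlMr // ge_min lexx orbT.
  by apply: ler_wpM2r; [exact: ltW T0|apply: le_trans (ler_norm L) _; rewrite lerDl].
apply: (@le_trans _ _ (K * T)); last by rewrite mulrC -ler_pdivlMr // ge_min lexx.
by apply: ler_wpM2r; [exact: ltW T0|rewrite lerDl].
Qed.

(** * The geodesic equation in Euler-Lagrange form *)

Section EulerLagrange.
Variables (R : realType) (d : nat).
Implicit Types (G : 'rV[R]_d -> 'M[R]_d) (x : R -> 'rV[R]_d).

Definition vel x (s : R) : 'rV[R]_d := \row_a derive1 (fun r => x r 0 a) s.

(** The velocity v is a parameter, so that partial derivatives of kinetic G v are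
taken at fixed velocity, as the Euler-Lagrange equations require. *)
Definition kinetic G (v y : 'rV[R]_d) : R := 2^-1 * bform (G y) v v.

(** The Legendre transform of the velocity: the derivative of the kinetic energy
with respect to its c-th component. *)
Definition momentum G x (c : 'I_d) (s : R) : R := \sum_b G (x s) c b * vel x s 0 b.

Definition euler_lagrange G x (t : R) (c : 'I_d) : R :=
  derive1 (momentum G x c) t - partial (kinetic G (vel x t)) c (x t).

Lemma bformE (A : 'M[R]_d) u v : bform A u v = \sum_a \sum_b u 0 a * A a b * v 0 b.
Proof.
rewrite /bform mxE exchange_big /=; apply: eq_bigr => b _.
by rewrite !mxE mulr_suml.
Qed.

Lemma is_derive_kinetic G v c y :
  (forall a b, derivable (fun z => G z a b) y 'e_c) ->
  is_derive y 'e_c (kinetic G v)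
    (2^-1 * \sum_a \sum_b v 0 a * partial (fun z => G z a b) c y * v 0 b).
Proof.
move=> dG.
have -> : kinetic G v = 2^-1 \*: (fun z => \sum_a \sum_b v 0 a * G z a b * v 0 b).
  by apply/funext => z; rewrite /kinetic bformE.
apply: is_deriveZ; apply: is_derive_bsum => a; apply: is_derive_bsum => b.
have := is_derive_mul (is_derive_mul (is_derive_cst (v 0 a) y 'e_c) (derivableP (dG a b)))
  (is_derive_cst (v 0 b) y 'e_c).
by rewrite mul0r add0r mulr0 addr0.
Qed.

Lemma is_derive_momentum G x t c :
  (forall a, derivable (fun s => x s 0 a) t 1) ->
  (forall a, derivable (fun s => vel x s 0 a) t 1) ->
  (forall a b, differentiable (fun y => G y a b) (x t)) ->
  is_derive t 1 (momentum G x c) (\sum_b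
    ((\sum_a vel x t 0 a * partial (fun y => G y c b) a (x t)) * vel x t 0 b +
     G (x t) c b * derive1 (fun s => vel x s 0 b) t)).
Proof.
move=> dx dv dG; apply: is_derive_bsum => b; apply: is_derive_mul.
  apply: (@is_derive_curve _ _ (fun y => G y c b)) => // a.
  by rewrite mxE derive1E; exact: derivableP.
by rewrite derive1E; exact: derivableP.
Qed.

(** Expanding both derivatives leaves G times the acceleration plus first
derivatives of G contracted with the velocity twice. By compatibility with the
metric the latter are sums of Christoffel symbols. The terms A, in which the lower
indices of the symbol include c, cancel; the terms B form the quadratic part of
the geodesic equation. *)
Lemma euler_lagrange_christoffel G x t c (Gam : 'I_d -> 'I_d -> 'I_d -> R) :
  (forall a, derivable (fun s => x s 0 a) t 1) ->
  (forall a, derivable (fun s => vel x s 0 a) t 1) ->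
  (forall a b, differentiable (fun y => G y a b) (x t)) ->
  (G (x t))^T = G (x t) ->
  (forall h a b, Gam h a b = Gam h b a) ->
  (forall c a b, partial (fun z => G z a b) c (x t) =
       \sum_l (Gam l c a * G (x t) l b + Gam l c b * G (x t) a l)) ->
  euler_lagrange G x t c = \sum_l G (x t) c l *
    (derive1 (fun s => vel x s 0 l) t
     + \sum_a \sum_b Gam l a b * vel x t 0 a * vel x t 0 b).
Proof.
move=> dx dv dG symG symGam compat.
have [_ EM] := is_derive_momentum c dx dv dG.
have [|_ EK] := @is_derive_kinetic G (vel x t) c (x t).
  by move=> a b; exact: diff_derivable.
rewrite /euler_lagrange derive1E EM /partial EK {EM EK}.
set v := vel x t; set acc := fun b => derive1 (fun s => vel x s 0 b) t.
rewrite big_split /= [X in _ = X](_ : _ = \sum_l G (x t) c l * acc l +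
  \sum_l G (x t) c l * \sum_a \sum_b Gam l a b * v 0 a * v 0 b); last first.
  by rewrite -big_split; apply: eq_bigr => l _; rewrite mulrDr.
rewrite addrAC [RHS]addrC; congr (_ + _).
have symE a b : G (x t) a b = G (x t) b a by rewrite -[in LHS]symG mxE.
pose A := \sum_a \sum_b \sum_l v 0 a * v 0 b * (Gam l a c * G (x t) l b).
pose B := \sum_a \sum_b \sum_l v 0 a * v 0 b * (Gam l a b * G (x t) c l).
have -> : \sum_l G (x t) c l * (\sum_a \sum_b Gam l a b * v 0 a * v 0 b) = B.
  under eq_bigr => l _ do (rewrite mulr_sumr; under eq_bigr => a _ do rewrite mulr_sumr).
  rewrite exchange_big; apply: eq_bigr => a _ /=; rewrite exchange_big.
  by apply: eq_bigr => b _; apply: eq_bigr => l _ /=; ring.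
have -> : \sum_b (\sum_a v 0 a * partial (fun y => G y c b) a (x t)) * v 0 b = A + B.
  under eq_bigr => b _ do rewrite mulr_suml.
  rewrite exchange_big -big_split; apply: eq_bigr => a _ /=.
  rewrite -big_split; apply: eq_bigr => b _ /=; rewrite -big_split compat /=.
  by rewrite mulr_sumr mulr_suml; apply: eq_bigr => l _; ring.
have -> : \sum_a \sum_b v 0 a * 'D_'e_c (fun z => G z a b) (x t) * v 0 b = A + A.
  rewrite {2}/A [X in _ = _ + X]exchange_big -big_split; apply: eq_bigr => a _ /=.
  rewrite -big_split; apply: eq_bigr => b _ /=; rewrite -big_split.
  rewrite -/(partial _ _ _) compat mulr_sumr mulr_suml; apply: eq_bigr => l _ /=.
  by rewrite !(symGam l c) (symE a l); ring.
by field.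
Qed.
End EulerLagrange.

Lemma exchange_big4 (R : realType) (I J K L : finType) (F : I -> J -> K -> L -> R) :
  \sum_i \sum_j \sum_k \sum_l F i j k l = \sum_k \sum_l \sum_i \sum_j F i j k l.
Proof.
rewrite [LHS](eq_bigr (fun i => \sum_k \sum_j \sum_l F i j k l)); last first.
  by move=> i _; exact: exchange_big.
rewrite exchange_big; apply: eq_bigr => k _ /=.
rewrite [LHS](eq_bigr (fun i => \sum_l \sum_j F i j k l)); last first.
  by move=> i _; exact: exchange_big.
exact: exchange_big.
Qed.

Lemma is_derive_map_curve (R : realType) d (psi : 'rV[R]_d -> 'rV[R]_d) (x : R -> 'rV[R]_d) s c :
  differentiable (fun y => psi y 0 c) (x s) ->
  (forall a, derivable (fun s => x s 0 a) s 1) ->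
  is_derive s (1 : R) (fun r => psi (x r) 0 c)
    (\sum_b vel x s 0 b * partial (fun y => psi y 0 c) b (x s)).
Proof.
move=> dpsi dx; apply: (@is_derive_curve _ _ (fun y => psi y 0 c)) => // a.
by rewrite mxE derive1E; exact: derivableP.
Qed.

Lemma is_derive_comp_dir (R : realType) d (psi : 'rV[R]_d -> 'rV[R]_d) (F : 'rV[R]_d -> R) (y : 'rV[R]_d) e :
  differentiable F (psi y) ->
  (forall c, derivable (fun z => psi z 0 c) y 'e_e) ->
  is_derive y 'e_e (F \o psi) (\sum_c partial (fun z => psi z 0 c) e y * partial F c (psi y)).
Proof.
move=> dF dpsi.
have H : is_derive (0 : R) 1 (F \o (fun s : R => psi (y + s *: 'e_e)))
    (\sum_c (\row_c partial (fun z => psi z 0 c) e y) 0 c * partial F c (psi (y + 0 *: 'e_e))).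
  apply: is_derive_curve => [|c]; first by rewrite scale0r addr0.
  rewrite mxE; apply/(is_derive_line (fun z => psi z 0 c)).
  by rewrite scale0r addr0; exact: derivableP.
have := (is_derive_line (F \o psi) y 'e_e 0 _).1 H.
rewrite scale0r addr0.
by under eq_bigr => c _ do rewrite mxE.
Qed.

Lemma expand_eq (R : realType) (a a' b b' g w z h : R) : a = a' -> b = b' ->
  (a * g + w * h) * z + w * g * b = a' * g * z + w * h * z + w * g * b'.
Proof. by move=> -> ->; rewrite mulrDl. Qed.

(** The Euler-Lagrange expression is a covector. Here G' is the pullback of G by
psi, so that momenta transform as covectors along the curve. Differentiating this
law yields a term with the derivative of the Jacobian of psi along the velocity,
while the gradient of the energy yields one with the derivative of psi_* v in the
direction e. The two cancel by symmetry of the second derivatives of psi. *)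
Lemma euler_lagrange_change (R : realType) d (V : set 'rV[R]_d) (psi : 'rV[R]_d -> 'rV[R]_d)
    (G G' : 'rV[R]_d -> 'M[R]_d) (x x' : R -> 'rV[R]_d) (t : R) (e : 'I_d) :
  open V -> (forall c, smooth_on V (fun y => psi y 0 c)) ->
  (forall y, V y -> forall a b, G' y a b = \sum_c \sum_k
     partial (fun z => psi z 0 c) a y * partial (fun z => psi z 0 k) b y * G (psi y) c k) ->
  (\forall s \near t, V (x' s)) -> (\forall s \near t, x s = psi (x' s)) ->
  (\forall s \near t, forall a, derivable (fun r => x' r 0 a) s 1) ->
  (forall a, derivable (fun s => vel x' s 0 a) t 1) ->
  (forall a, derivable (fun s => vel x s 0 a) t 1) ->
  (forall a b, differentiable (fun y => G y a b) (x t)) ->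
  (G (x t))^T = G (x t) ->
  euler_lagrange G' x' t e =
    \sum_c partial (fun y => psi y 0 c) e (x' t) * euler_lagrange G x t c.
Proof.
move=> oV spsi GE Vx' xE dx' dvx' dvx dG symG.
pose D c a y := partial (fun z => psi z 0 c) a y.
have Vt : V (x' t) by exact: nbhs_singleton Vx'.
have xt : x t = psi (x' t) by exact: nbhs_singleton xE.
have dx't : forall a, derivable (fun r => x' r 0 a) t 1 by exact: nbhs_singleton dx'.
have dpsi y c : V y -> differentiable (fun y => psi y 0 c) y.
  exact: smooth_on_differentiable.
have sD c a : smooth_on V (D c a) by exact: smooth_on_partial.
have dxs : \forall s \near t, forall c,
    is_derive s (1 : R) (fun r => x r 0 c) (\sum_b vel x' s 0 b * D c b (x' s)).
  have xE2 : \forall s \near t, \forall r \near s, x r = psi (x' r) by exact: nbhs_interior.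
  near=> s => c.
  apply: (near_eq_is_derive (f := fun r => psi (x' r) 0 c)).
    have : \forall r \near s, x r = psi (x' r) by near: s.
    by apply: filterS => r ->.
  apply: is_derive_map_curve; last by move=> a; move: a; near: s.
  by apply: dpsi; near: s.
have vel_near : \forall s \near t, forall c, vel x s 0 c = \sum_b vel x' s 0 b * D c b (x' s).
  by apply: filterS dxs => s dxs c; rewrite mxE derive1E; have [_ ->] := dxs c.
have momE : \forall s \near t, \sum_c D c e (x' s) * momentum G x c s = momentum G' x' e s.
  near=> s.
  have Vs : V (x' s) by near: s.
  have xs : x s = psi (x' s) by near: s.
  have vs : forall c, vel x s 0 c = \sum_b vel x' s 0 b * D c b (x' s) by near: s.
  rewrite /momentum.
  under [RHS]eq_bigr => b _ do rewrite GE // mulr_suml.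
  rewrite [RHS]exchange_big; apply: eq_bigr => c _ /=.
  under [RHS]eq_bigr => b _ do rewrite mulr_suml.
  rewrite [RHS]exchange_big mulr_sumr; apply: eq_bigr => k _ /=.
  rewrite vs xs !mulr_sumr; apply: eq_bigr => b _; rewrite /D; ring.
have dxt c : derivable (fun r => x r 0 c) t 1 by have := nbhs_singleton dxs; move=> /(_ c)[].
have dmom c : derivable (momentum G x c) t 1.
  by have [+ _] := is_derive_momentum c dxt dvx dG.
have dD c a : is_derive t 1 (fun r => D c a (x' r)) (\sum_b vel x' t 0 b * partial (D c a) b (x' t)).
  apply: (@is_derive_curve _ _ (D c a)) => [|b]; first exact (@smooth_on_differentiable _ _ V oV (D c a) (x' t) (sD c a) Vt).
  by rewrite mxE derive1E; exact: derivableP.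
have M' : is_derive t 1 (momentum G' x' e) (\sum_c
    ((\sum_b vel x' t 0 b * partial (D c e) b (x' t)) * momentum G x c t +
     D c e (x' t) * derive1 (momentum G x c) t)).
  apply: near_eq_is_derive momE _; apply: is_derive_bsum => c.
  apply: is_derive_mul.
  by rewrite derive1E; exact: derivableP.
(* W y is the image under the differential of psi at y of the fixed vector v. *)
set v := vel x' t; pose W c y := \sum_b v 0 b * D c b y.
have vt c : vel x t 0 c = W c (x' t) by have := nbhs_singleton vel_near; exact.
have kinE : \forall y \near x' t,
    2^-1 * (\sum_c \sum_k W c y * G (psi y) c k * W k y) = kinetic G' v y.
  apply: filterS (near_open oV Vt) => y Vy; rewrite /kinetic bformE; congr (_ * _).
  under [RHS]eq_bigr => a _ do under eq_bigr => b _ do rewrite GE //.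
  rewrite /W.
  transitivity (\sum_c \sum_k \sum_a \sum_b v 0 a * D c a y * G (psi y) c k * (v 0 b * D k b y)).
    apply: eq_bigr => c _; apply: eq_bigr => k _; rewrite !mulr_suml.
    by apply: eq_bigr => a _; rewrite mulr_sumr.
  rewrite exchange_big4; apply: eq_bigr => a _; apply: eq_bigr => b _.
  rewrite mulr_sumr mulr_suml; apply: eq_bigr => c _.
  by rewrite mulr_sumr mulr_suml; apply: eq_bigr => k _; rewrite /D; ring.
have dW c : is_derive (x' t) 'e_e (W c) (\sum_b v 0 b * partial (D c b) e (x' t)).
  apply: is_derive_bsum => b.
  have Db : is_derive (x' t) 'e_e (D c b) (partial (D c b) e (x' t)).
    apply: derivableP; exact: smooth_on_derivable (sD c b) Vt.
  have := is_derive_mul (is_derive_cst (v 0 b) (x' t) 'e_e) Db.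
  by rewrite mul0r add0r.
pose dG' c k := \sum_h D h e (x' t) * partial (fun z => G z c k) h (x t).
have dGpsi c k : is_derive (x' t) 'e_e (fun y => G (psi y) c k) (dG' c k).
  rewrite /dG' xt; apply: (@is_derive_comp_dir _ _ psi (fun z => G z c k)).
    by rewrite -xt.
  by move=> a; apply: smooth_on_derivable Vt.
have K' : is_derive (x' t) 'e_e (kinetic G' v) (2^-1 * \sum_c \sum_k
    (((\sum_b v 0 b * partial (D c b) e (x' t)) * G (x t) c k + W c (x' t) * dG' c k) * W k (x' t)
     + W c (x' t) * G (x t) c k * (\sum_b v 0 b * partial (D k b) e (x' t)))).
  rewrite xt; apply: near_eq_is_derive kinE _; apply: is_deriveZ.
  apply: is_derive_bsum => c; apply: is_derive_bsum => k.
  by apply: is_derive_mul => //; apply: is_derive_mul.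
have K c : partial (kinetic G (vel x t)) c (x t) =
    2^-1 * \sum_a \sum_b W a (x' t) * partial (fun z => G z a b) c (x t) * W b (x' t).
  have [|_ E] := @is_derive_kinetic _ _ G (vel x t) c (x t).
    by move=> a b; exact: diff_derivable.
  apply: etrans E _; by congr (_ * _); apply: eq_bigr => a _; apply: eq_bigr => b _; rewrite !vt.
have [_ EM] := M'; have [_ EK] := K'.
have -> : euler_lagrange G' x' t e = 'D_1 (momentum G' x' e) t - 'D_('e_e) (kinetic G' v) (x' t).
  by rewrite /euler_lagrange derive1E.
rewrite EM EK big_split /=.
under [RHS]eq_bigr => c _ do rewrite mulrBr K.
rewrite sumrB.
pose dv c := \sum_b v 0 b * partial (D c e) b (x' t).
(* The symmetry of second derivatives enters here. *)
have dWE c : \sum_b v 0 b * partial (D c b) e (x' t) = dv c.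
  by apply: eq_bigr => b _; rewrite (smooth_on_schwarz oV _ _ (spsi c) Vt).
have symE a b : G (x t) a b = G (x t) b a by rewrite -[in LHS]symG mxE.
have momW c : momentum G x c t = \sum_k G (x t) c k * W k (x' t).
  by apply: eq_bigr => k _; rewrite vt.
have S1 : \sum_c \sum_k dv c * G (x t) c k * W k (x' t) = \sum_c dv c * momentum G x c t.
  apply: eq_bigr => c _; rewrite momW mulr_sumr.
  by apply: eq_bigr => k _; rewrite mulrA.
have S2 : \sum_c \sum_k W c (x' t) * G (x t) c k * dv k = \sum_c dv c * momentum G x c t.
  rewrite -S1 exchange_big; apply: eq_bigr => c _; apply: eq_bigr => k _ /=.
  by rewrite (symE k c) mulrC [W _ _ * _]mulrC mulrA.
have S3 : \sum_c \sum_k W c (x' t) * dG' c k * W k (x' t) = \sum_h D h e (x' t) *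
    \sum_c \sum_k W c (x' t) * partial (fun z => G z c k) h (x t) * W k (x' t).
  under [RHS]eq_bigr => h _ do (rewrite mulr_sumr; under eq_bigr => c _ do rewrite mulr_sumr).
  rewrite [RHS]exchange_big; apply: eq_bigr => c _ /=.
  rewrite [RHS]exchange_big; apply: eq_bigr => k _ /=.
  rewrite /dG' mulr_sumr mulr_suml; apply: eq_bigr => h _.
  by rewrite !mulrA [W c _ * _]mulrC.
have -> : 2^-1 * \sum_c \sum_k
    (((\sum_b v 0 b * partial (D c b) e (x' t)) * G (x t) c k + W c (x' t) * dG' c k) * W k (x' t)
     + W c (x' t) * G (x t) c k * (\sum_b v 0 b * partial (D k b) e (x' t))) =
    \sum_c dv c * momentum G x c t + \sum_c D c e (x' t) *
      (2^-1 * \sum_a \sum_b W a (x' t) * partial (fun z => G z a b) c (x t) * W b (x' t)).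
  have -> : \sum_c D c e (x' t) *
      (2^-1 * \sum_a \sum_b W a (x' t) * partial (fun z => G z a b) c (x t) * W b (x' t)) =
      2^-1 * \sum_c \sum_k W c (x' t) * dG' c k * W k (x' t).
    by rewrite S3 mulr_sumr; apply: eq_bigr => c _; rewrite mulrCA.
  transitivity (2^-1 * (\sum_c \sum_k dv c * G (x t) c k * W k (x' t) +
      \sum_c \sum_k W c (x' t) * dG' c k * W k (x' t) +
      \sum_c \sum_k W c (x' t) * G (x t) c k * dv k)).
    congr (_ * _); rewrite -!big_split; apply: eq_bigr => c _ /=.
    rewrite -!big_split; apply: eq_bigr => k _ /=.
    exact: expand_eq (dWE c) (dWE k).
  rewrite S1 S2; move: (\sum_c dv c * _) (\sum_c \sum_k _) => A B; by field.
by rewrite opprD addrACA subrr add0r.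
Unshelve. all: by end_near. Qed.

(** * Geodesics of a Riemannian manifold *)

Section ChartLemmas.
Variables (R : realType) (n : nat) (M : manifold R n).
Implicit Types (i j : mchart M).

(** The domain, in coordinates, of a change of charts. *)
Lemma chart_inter_open i j : open (mcoord M i @` (mdom M i `&` mdom M j)).
Proof.
rewrite openE => _ [x [ix jx] <-].
have iy : (mcoord M i @` mdom M i) (mcoord M i x) by exists x.
have n1 : \forall y \near mcoord M i x, (mcoord M i @` mdom M i) y.
  by apply: open_nbhs_nbhs; split=> //; exact: m_image_open.
have n2 : \forall y \near mcoord M i x, mdom M j (mpar M i y).
  have cp : {for mcoord M i x, continuous (mpar M i)} by apply: m_par_cont; rewrite inE.
  apply: cp; rewrite m_coordK //; apply: open_nbhs_nbhs; split=> //; exact: m_dom_open.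
apply: filterS (near_and n1 n2) => y [[p ip <-]].
by rewrite m_coordK // => jp; exists p.
Qed.

End ChartLemmas.

(** The Koszul formula: the first derivatives of the metric determine the
Christoffel symbols. *)
Lemma koszul_formula (R : realType) d (G : 'M[R]_d) (dG : 'I_d -> 'I_d -> 'I_d -> R)
    (Gam : 'I_d -> 'I_d -> 'I_d -> R) :
  G^T = G -> (forall h a b, Gam h a b = Gam h b a) ->
  (forall c a b, dG c a b = \sum_l (Gam l c a * G l b + Gam l c b * G a l)) ->
  forall a b c, \sum_l Gam l a b * G l c = (dG a b c + dG b a c - dG c a b) / 2.
Proof.
move=> symG symGam dGE a b c; pose K u v w := \sum_l Gam l u v * G l w.
have symE u v : G u v = G v u by rewrite -[in LHS]symG mxE.
have KC u v w : K u v w = K v u w by apply: eq_bigr => l _; rewrite symGam.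
have E u v w : dG u v w = K u v w + K u w v.
  rewrite dGE big_split; congr (_ + _).
  by apply: eq_bigr => l _; rewrite symE.
rewrite !E -/(K a b c) (KC b a) (KC c a) (KC c b); move: (K a b c) (K a c b) (K b c a) => x y w.
by field.
Qed.

(** A Levi-Civita connection is prescribed point by point; that it is smooth
follows from the Koszul formula. *)
Lemma smooth_christoffel (R : realType) (n : nat) (M : manifold R n)
    (g : bilinear_field (charts M)) (nabla : connection (charts M)) i h a b :
  riemannian_metric g -> levi_civita g nabla ->
  smooth_on (mcoord M i @` mdom M i) (fun y => nabla i y h a b).
Proof.
move=> gR lc; have [gs gsym gpos _] := gR.
set U := _ @` _; have oU : open U by exact: m_image_open.
pose dg y c a b := partial (fun z => g i z a b) c y.
apply: (@smooth_on_ext _ _ U oU (fun y => \sum_c ((dg y a b c + dg y b a c - dg y c a b) / 2) *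
   invmx (g i y) c h)).
  move=> y Uy; have [x ix xy] := Uy.
  have gu : g i y \in unitmx by rewrite -xy; exact: riemannian_metric_unit.
  have [sG cG] := lc i y Uy.
  have gsy : (g i y)^T = g i y by rewrite -xy gsym.
  transitivity (((\row_l nabla i y l a b) *m g i y *m invmx (g i y)) 0 h).
    rewrite [RHS]mxE; apply: eq_bigr => c _; congr (_ * _).
    rewrite mxE -(@koszul_formula _ _ (g i y) (dg y) (fun h a b => nabla i y h a b) gsy sG cG).
    by apply: eq_bigr => l _; rewrite mxE.
  by rewrite -mulmxA mulmxV // mulmx1 mxE.
have sdg c u v : smooth_on U (fun y => dg y c u v).
  by apply: smooth_on_partial; exact: gs.
apply: smooth_on_sum => // c _; apply: smooth_onM => //.
  apply: smooth_onM => //; last exact: smooth_on_cst.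
  by apply: smooth_onB => //; apply: smooth_onD.
apply: smooth_on_invmx => // [y [x ix <-]|]; first exact: riemannian_metric_unit.
exact: gs.
Qed.

Lemma unitmx_sum_eq0 (R : realType) n (A : 'M[R]_n) (E : 'I_n -> R) :
  A \in unitmx -> (forall c, \sum_l A c l * E l = 0) -> forall l, E l = 0.
Proof.
move=> uA AE l; have : A *m (\col_l E l) = 0.
  apply/colP => c; rewrite !mxE -[RHS](AE c).
  by apply: eq_bigr => k _; rewrite mxE.
move=> /(congr1 (mulmx (invmx A))); rewrite mulmxA mulVmx // mul1mx mulmx0.
by move/colP => /(_ l); rewrite !mxE.
Qed.

Lemma velE (R : realType) d (x : R -> 'rV[R]_d) a :
  (fun s => vel x s 0 a) = derive1 (fun r => x r 0 a).
Proof. by apply/funext => s; rewrite mxE. Qed.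

Section ChartGeodesic.
Variables (R : realType) (n : nat) (M : manifold R n)
    (g : bilinear_field (charts M)) (nabla : connection (charts M)).
Hypotheses (gR : riemannian_metric g) (lc : levi_civita g nabla).

Definition geodesic_equation (i : mchart M) (x : R -> 'rV[R]_n) (t : R) : Prop :=
  forall h, derive1 (fun s => vel x s 0 h) t
    + \sum_a \sum_b nabla i (x t) h a b * vel x t 0 a * vel x t 0 b = 0.

(** The metric being invertible, the covector euler_lagrange vanishes if and only if
the acceleration does. *)
Lemma geodesic_equationP (i : mchart M) (x : R -> 'rV[R]_n) (t : R) :
  (mcoord M i @` mdom M i) (x t) ->
  (forall a, derivable (fun s => x s 0 a) t 1) ->
  (forall a, derivable (fun s => vel x s 0 a) t 1) ->
  geodesic_equation i x t <-> forall c, euler_lagrange (g i) x t c = 0.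
Proof.
move=> Uxt dx dv; have [gs gsym _ _] := gR; have [sG cG] := lc Uxt.
have E c : euler_lagrange (g i) x t c = \sum_l g i (x t) c l *
    (derive1 (fun s => vel x s 0 l) t
     + \sum_a \sum_b nabla i (x t) l a b * vel x t 0 a * vel x t 0 b).
  apply: euler_lagrange_christoffel => //.
    move=> a b; apply: (smooth_on_differentiable _ (gs i a b) Uxt); exact: m_image_open.
  by have [p ip <-] := Uxt; exact: gsym.
split=> [eq0 c|EL0].
  by rewrite E big1 // => l _; rewrite eq0 mulr0.
apply: (@unitmx_sum_eq0 _ _ (g i (x t))); last by move=> c; rewrite -E.
by have [p ip <-] := Uxt; exact: riemannian_metric_unit.
Qed.

(** A curve that solves the geodesic equation in one chart solves it in all
others, because the Euler-Lagrange expressions in two charts differ by a Jacobian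
matrix. *)
Lemma geodesic_of_chart (J : set R) (gam : R -> M) (i : mchart M) :
  open J -> (forall t, J t -> mdom M i (gam t)) ->
  let x := fun t => mcoord M i (gam t) in
  (forall k a, Dk_on k J (fun t => x t 0 a)) ->
  (forall t, J t -> geodesic_equation i x t) ->
  @geodesic R n (charts M) nabla J gam.
Proof.
move=> oJ ig x Dx gx.
have cgam t : J t -> {for t, continuous gam}.
  move=> Jt; have near_J : \forall s \near t, mpar M i (x s) = gam s.
    by apply: filterS (open_nbhs_nbhs (conj oJ Jt)) => s Js; rewrite m_coordK //; exact: ig.
  apply: continuous_near_eq near_J _.
  apply: (@continuous_comp _ _ _ x (mpar M i)).
    apply: differentiable_continuous; apply/derivable1_diffP.
    apply/derivable_mxP => k a; rewrite ord1.
    by have [+ _] := Dx 1 a; exact.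
  by apply: m_par_cont; rewrite inE; exists (gam t) => //; exact: ig.
pose J' j := [set t | J t /\ mdom M j (gam t)].
have oJ' j : open (J' j).
  rewrite openE => t [Jt jt].
  have nj : \forall s \near t, mdom M j (gam s).
    apply: (cgam t Jt); apply: open_nbhs_nbhs; split=> //; exact: m_dom_open.
  exact: near_and (open_nbhs_nbhs (conj oJ Jt)) nj.
have DJ' j k a : Dk_on k (J' j) (fun t => mcoord M j (gam t) 0 a).
  apply: (@Dk_on_ext _ _ (oJ' j) _ ((fun y => mcoord M j (mpar M i y) 0 a) \o x)).
    by move=> t [Jt _]; rewrite /= m_coordK //; exact: ig.
  apply: (Dk_on_comp (oJ' j) (@chart_inter_open _ _ M i j)).
  - exact: m_transition.
  - by move=> t [Jt jt]; exists (gam t) => //; split=> //; exact: ig.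
  - by move=> b; apply: Dk_onS (Dx k b) => t [].
have dcoord j a t k : J' j t -> derivable (derive1n k (fun t => mcoord M j (gam t) 0 a)) t 1.
  by move=> J't; apply: (Dk_onP (J' j) _).2 J't => k'; exact: DJ'.
split=> [t Jt j jt|t Jt j jt h].
  split; last by move=> a k; exact: dcoord.
  have J't : J' j t by [].
  by apply: filterS (open_nbhs_nbhs (conj (oJ' j) J't)) => s [].
have J't : J' j t by [].
pose xj := fun t => mcoord M j (gam t).
have nearJ' : \forall s \near t, J' j s by exact: open_nbhs_nbhs (conj (oJ' j) J't).
have Uj : (mcoord M j @` mdom M j) (xj t) by exists (gam t).
have Ui : (mcoord M i @` mdom M i) (x t) by exists (gam t) => //; exact: ig.
have dxj a : derivable (fun s => xj s 0 a) t 1 by exact: (dcoord j a t 0).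
have dvj a : derivable (fun s => vel xj s 0 a) t 1.
  by rewrite velE; exact: (dcoord j a t 1).
have dx a : derivable (fun s => x s 0 a) t 1 by have [+ _] := Dx 1 a; exact.
have dv a : derivable (fun s => vel x s 0 a) t 1.
  by rewrite velE; have [_ [+ _]] := Dx 2 a; exact.
have ELi := (geodesic_equationP Ui dx dv).1 (gx t Jt).
have [gs gsym _ gtr] := gR.
have ELj : forall c, euler_lagrange (g j) xj t c = 0.
  move=> c.
  rewrite (@euler_lagrange_change _ _ _ (fun y => mcoord M i (mpar M j y)) (g i) (g j) x xj t c
    (@chart_inter_open _ _ M j i)).
  - by rewrite big1 // => k _; rewrite ELi mulr0.
  - by move=> b; exact: m_transition.
  - move=> y [q [jq iq] <-] a b; rewrite m_coordK //.
    by rewrite (gtr i j q).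
  - by apply: filterS nearJ' => s [Js js]; exists (gam s) => //; split=> //; exact: ig.
  - by apply: filterS nearJ' => s [Js js]; rewrite m_coordK.
  - by apply: filterS nearJ' => s J's a; exact: (dcoord j a s 0).
  - by [].
  - by [].
  - move=> a b; apply: (smooth_on_differentiable _ (gs i a b) Ui); exact: m_image_open.
  - by apply: gsym; exact: ig.
have := (geodesic_equationP Uj dxj dvj).2 ELj h.
rewrite velE => E; rewrite -[RHS]E.
by congr (_ + _); apply: eq_bigr => a _; apply: eq_bigr => b _; rewrite !mxE.
Qed.

(** In coordinates the geodesic equation is the first order system F for the pair
of position and velocity. Its solution is smooth by bootstrapping: if position and
velocity are k times differentiable, so is the right-hand side. *)
Lemma geodesic_exists (i : mchart M) (p : M) (v : 'rV[R]_n) : mdom M i p ->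
  exists2 T : R, 0 < T & exists gam : R -> M,
    [/\ @geodesic R n (charts M) nabla `]- T, T[ gam, gam 0 = p &
     forall a, derive1 (@curve_coord R n (charts M) gam i a) 0 = v 0 a].
Proof.
move=> ip; set U := mcoord M i @` mdom M i.
have oU : open U by exact: m_image_open.
have Up : U (mcoord M i p) by exists p.
pose acc (w : 'rV[R]_(n + n)) h := \sum_a \sum_b
  nabla i (lsubmx w) h a b * w 0 (rshift n a) * w 0 (rshift n b).
pose F (w : 'rV[R]_(n + n)) : 'rV[R]_(n + n) := row_mx (rsubmx w) (\row_h (- 1 * acc w h)).
pose z := row_mx (mcoord M i p) v.
have sN h a b : smooth_on U (fun y => nabla i y h a b) by exact (smooth_christoffel i h a b gR lc).
have lipF : loc_lip z F.
  apply: loc_lip_row => c; case: (splitP c) => k ck.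
    have -> : (fun y => F y 0 c) = (fun y => y 0 (rshift n k)).
      apply/funext => y; have -> : c = lshift n k by apply: ord_inj; rewrite ck.
      by rewrite /F row_mxEl mxE.
    exact: loc_lip_coord.
  have -> : (fun y => F y 0 c) = (fun y => - 1 * acc y k).
    apply/funext => y; have -> : c = rshift n k by apply: ord_inj; rewrite ck.
    by rewrite /F row_mxEr mxE.
  apply: loc_lipM; first exact: loc_lip_cst.
  apply: loc_lip_sum => a; apply: loc_lip_sum => b.
  apply: loc_lipM; last exact: loc_lip_coord.
  apply: loc_lipM; last exact: loc_lip_coord.
  apply: (@loc_lip_lsubmx _ _ _ (fun y => nabla i y k a b)).
  by rewrite row_mxKl; exact: smooth_on_lip oU (sN k a b) Up.
have [r [L [r0 lF rU]]] : exists r L : R,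
    [/\ 0 < r, lip_ball z r L F & forall w, ball z r w -> U (lsubmx w)].
  have [L lF] := lipF; have /nbhs_ballP[r1 /= r10 r1U] : nbhs (mcoord M i p) U.
    exact: open_nbhs_nbhs.
  near (0 : R)^'+ => r; exists r, L; split.
  - by near: r; exact: nbhs_right_gt.
  - by near: r.
  - move=> w zw; apply: r1U; rewrite -[mcoord M i p](@row_mxKl _ _ _ _ _ v) -/z.
    have rr1 : r <= r1 by near: r; exact: nbhs_right_le.
    move: (le_ball rr1 zw); rewrite -!ball_normE /=; apply: le_lt_trans.
    by rewrite -linearB; exact: norm_lsubmx.
have [T T0 [u [u0 uP]]] := ode_exists r0 lF.
pose x t := lsubmx (u t); pose w t := rsubmx (u t).
have Ux t : `|t| < T -> U (x t) by move=> /uP[/rU].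
have dx (t : R) a : `|t| < T -> is_derive t 1 (fun s => x s 0 a) (w t 0 a).
  move=> /uP[_ /(_ (lshift n a))]; rewrite /F row_mxEl.
  by rewrite (_ : (fun s => u s 0 (lshift n a)) = (fun s => x s 0 a)) //; apply/funext => s; rewrite mxE.
have dw (t : R) h : `|t| < T -> is_derive t 1 (fun s => w s 0 h)
    (- 1 * \sum_a \sum_b nabla i (x t) h a b * w t 0 a * w t 0 b).
  move=> /uP[_ /(_ (rshift n h))]; rewrite /F row_mxEr mxE /acc.
  rewrite (_ : (fun s => u s 0 (rshift n h)) = (fun s => w s 0 h)); last first.
    by apply/funext => s; rewrite mxE.
  have wE a : w t 0 a = u t 0 (rshift n a) by rewrite mxE.
  by under [X in - 1 * X]eq_bigr => a _ do under eq_bigr => b _ do rewrite -!wE.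
exists T => //; pose J := [set` `]- T, T[ ].
have JT t : J t = (`|t| < T) :> Prop by rewrite /J /= in_itv /= -ltr_norml.
have oJ : open J by exact: itv_open.
(* The bootstrapping. *)
have Dxw k : forall a, Dk_on k J (fun t => x t 0 a) /\ Dk_on k J (fun t => w t 0 a).
  elim: k => [//|k IH] a; split; split.
  - by move=> t; rewrite JT => /(dx t a)[].
  - have [_] := IH a; apply: (Dk_on_ext oJ) => t; rewrite JT derive1E.
    by move=> /(dx t a)[].
  - by move=> t; rewrite JT => /(dw t a)[].
  - apply: (@Dk_on_ext _ _ oJ _ (fun t => - 1 * \sum_c \sum_b nabla i (x t) a c b * w t 0 c * w t 0 b)).
      by move=> t; rewrite JT derive1E => /(dw t a)[].
    apply: Dk_onM => //; first exact: Dk_on_cst.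
    apply: Dk_on_sum => // c; apply: Dk_on_sum => // b.
    apply: Dk_onM => //; last by case: (IH b).
    apply: Dk_onM => //; last by case: (IH c).
    apply: (@Dk_on_comp _ _ oJ k _ U (fun y => nabla i y a c b) x) => //.
      by move=> t; rewrite JT; exact: Ux.
    by move=> e; case: (IH e).
have xK t : `|t| < T -> mcoord M i (mpar M i (x t)) = x t.
  by move=> /Ux[q iq <-]; rewrite m_coordK.
pose gam t := mpar M i (x t).
have x0 : x 0 = mcoord M i p by rewrite /x u0 row_mxKl.
have T00 : `|0 : R| < T by rewrite normr0.
have eqx a t : J t -> \forall s \near t, x s 0 a = mcoord M i (gam s) 0 a.
  move=> Jt; apply: filterS (open_nbhs_nbhs (conj oJ Jt)) => s.
  by rewrite JT => sT; rewrite xK.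
exists gam; split.
- apply: (@geodesic_of_chart J gam i) => //.
  + by move=> t; rewrite JT => /Ux[q iq]; rewrite /gam => <-; rewrite m_coordK.
  + move=> k a; apply: (@Dk_on_ext _ _ oJ _ (fun t => x t 0 a)); last by case: (Dxw k a).
    by move=> t; rewrite JT => tT; rewrite xK.
  + move=> t Jt h.
    have vel_near s a : J s -> vel (fun t => mcoord M i (gam t)) s 0 a = w s 0 a.
      move=> Js; rewrite mxE derive1E.
      have : `|s| < T by rewrite -JT.
      by move=> /(dx s a)[_ <-]; apply: near_eq_derive; apply: filterS (eqx a s Js) => r' ->.
    have tT : `|t| < T by rewrite -JT.
    have -> : derive1 (fun s => vel (fun t => mcoord M i (gam t)) s 0 h) t =
        - 1 * \sum_a \sum_b nabla i (x t) h a b * w t 0 a * w t 0 b.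
      rewrite derive1E; have [_ <-] := dw t h tT; apply: near_eq_derive.
      by apply: filterS (open_nbhs_nbhs (conj oJ Jt)) => s Js; exact: vel_near.
    rewrite xK //; under [X in _ + X]eq_bigr => a _ do under eq_bigr => b _ do rewrite !vel_near //.
    by rewrite mulN1r addNr.
- by rewrite /gam x0 m_coordK.
- move=> a; rewrite derive1E.
  have J0 : J 0 by rewrite JT.
  have <- : w 0 0 a = v 0 a by rewrite /w u0 row_mxKr.
  have [_ <-] := dx 0 a T00; apply: near_eq_derive.
  by apply: filterS (eqx a 0 J0) => s ->.
Unshelve. all: by end_near. Qed.

End ChartGeodesic.

(** * The rescaled Sasaki metric *)

(** Expands, over all multi-indices k, the product over l of the entries
(a l, c l) of h *m h'. *)
Lemma sum_prod_delta (R : realType) n r (h h' : 'M[R]_n) (a c : {ffun 'I_r -> 'I_n}) :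
  h *m h' = 1%:M ->
  \sum_(k : {ffun 'I_r -> 'I_n}) (\prod_(l < r) h (a l) (k l)) * (\prod_(l < r) h' (k l) (c l))
  = (a == c)%:R.
Proof.
move=> hh'.
under eq_bigr => k _ do rewrite -big_split /=.
rewrite -(bigA_distr_bigA (fun (l : 'I_r) j => h (a l) j * h' j (c l))) /=.
have E l : \sum_j h (a l) j * h' j (c l) = (a l == c l)%:R.
  by move/matrixP: hh' => /(_ (a l) (c l)); rewrite !mxE.
under eq_bigr => l _ do rewrite E.
have [->|ac] := eqVneq a c; first by rewrite big1 // => l _; rewrite eqxx.
have [l al] : exists l, a l != c l.
  apply/existsP; rewrite -negb_forall; apply: contra ac => /forallP al.
  by apply/eqP/ffunP => l; apply/eqP.
by rewrite (bigD1 l) //= (negPf al) mul0r.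
Qed.

(** The tensor B below is dual to the basis tensor of multi-index k0, so that its
inner product with A is the component A k0. *)
Lemma tensor_inner_nondegenerate (R : realType) n p q (g : 'M[R]_n) (A : tidx n p q -> R) :
  g \in unitmx -> (forall B, tensor_inner g B A = 0) -> forall k, A k = 0.
Proof.
move=> gu gA k0.
pose B (k : tidx n p q) := (\prod_(l < p) invmx g (k0.1 l) (k.1 l)) *
   (\prod_(m < q) g (k0.2 m) (k.2 m)).
have delta (c : tidx n p q) : \sum_(k : tidx n p q) (\prod_(l < p) g (k.1 l) (c.1 l)) *
    (\prod_(m < q) (invmx g) (k.2 m) (c.2 m)) * B k = (k0 == c)%:R.
  transitivity ((\sum_(a : {ffun 'I_p -> 'I_n}) (\prod_(l < p) invmx g (k0.1 l) (a l)) * (\prod_(l < p) g (a l) (c.1 l)))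
    * (\sum_(b : {ffun 'I_q -> 'I_n}) (\prod_(m < q) g (k0.2 m) (b m)) * (\prod_(m < q) invmx g (b m) (c.2 m)))).
    rewrite big_distrlr /= pair_bigA /=; apply: eq_bigr => k _.
    by rewrite /B mulrC mulrACA.
  rewrite !sum_prod_delta ?mulVmx ?mulmxV // -natrM mulnb.
  by case: (k0) (c) => [a b] [a' b'].
rewrite -[RHS](gA B) /tensor_inner exchange_big /= (bigD1 k0) //= [X in _ + X]big1.
  by rewrite addr0 -mulr_suml delta eqxx mul1r.
by move=> c ck; rewrite -mulr_suml delta eq_sym (negPf ck) mul0r.
Qed.

Lemma lsubmx_delta_l (R : realType) m k a :
  lsubmx ('e_(lshift k a) : 'rV[R]_(m + k)) = 'e_a.
Proof. by apply/rowP => b; rewrite !mxE eqxx (inj_eq (@lshift_inj _ _)). Qed.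

Lemma lsubmx_delta_r (R : realType) m k a :
  lsubmx ('e_(rshift m a) : 'rV[R]_(m + k)) = 0.
Proof. by apply/rowP => b; rewrite !mxE eqxx eq_lrshift. Qed.

Section Sasaki.
Variables (R : realType) (n p q : nat).
Local Notation N := #|tidx n p q|.

Definition fibre (y : 'rV[R]_(n + N)) (k : tidx n p q) : R := rsubmx y 0 (enum_rank k).

Lemma fibreK (y : 'rV[R]_(n + N)) : row_mx (lsubmx y) (tensor_row (fibre y)) = y.
Proof.
rewrite -[RHS]hsubmxK; congr row_mx; apply/rowP => k.
by rewrite mxE /fibre enum_valK.
Qed.

Lemma fibre_row_mx (x : 'rV[R]_n) (t : tidx n p q -> R) k :
  fibre (row_mx x (tensor_row t)) k = t k.
Proof. by rewrite /fibre row_mxKr mxE enum_rankK. Qed.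

(** The component of v along the fibre in the splitting of the tangent space of
the bundle into horizontal and vertical vectors. *)
Definition vertical_part (Gam : 'I_n -> 'I_n -> 'I_n -> R) (t : tidx n p q -> R)
    (v : 'rV[R]_(n + N)) (k : tidx n p q) : R :=
  fibre v k - fibre (hlift Gam t (lsubmx v)) k.

Lemma hlift_vertical_part Gam t v : v = hlift Gam t (lsubmx v) + vlift (vertical_part Gam t v).
Proof.
rewrite -[LHS]hsubmxK /hlift /vlift add_row_mx addr0; congr row_mx.
apply/rowP => k; rewrite !mxE /vertical_part /fibre enum_valK /hlift row_mxKr !mxE.
by rewrite addrC subrK.
Qed.

Lemma bformDl (d : nat) (A : 'M[R]_d) u1 u2 v : bform A (u1 + u2) v = bform A u1 v + bform A u2 v.
Proof. by rewrite /bform !mulmxDl mxE. Qed.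

Lemma bformDr (d : nat) (A : 'M[R]_d) u v1 v2 : bform A u (v1 + v2) = bform A u v1 + bform A u v2.
Proof. by rewrite /bform linearD mulmxDr mxE. Qed.

Lemma bformC (d : nat) (A : 'M[R]_d) u v : A^T = A -> bform A u v = bform A v u.
Proof.
move=> sA; rewrite /bform -[in LHS](trmxK (u *m A *m v^T)) mxE.
by rewrite !trmx_mul trmxK sA mulmxA.
Qed.

Lemma bform_delta (d : nat) (A : 'M[R]_d) a b : bform A 'e_a 'e_b = A a b.
Proof. by rewrite /bform -rowE trmx_delta -colE !mxE. Qed.

Lemma bform_deltal (d : nat) (A : 'M[R]_d) a v : bform A 'e_a v = \sum_b A a b * v 0 b.
Proof. by rewrite /bform -rowE mxE; apply: eq_bigr => b _; rewrite !mxE. Qed.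

Variables (M : manifold R n) (g : bilinear_field (charts M)) (nabla : connection (charts M))
    (f : M -> R) (Sgf : bilinear_field (tensor_bundle M p q)).
Hypotheses (gR : riemannian_metric g) (lc : levi_civita g nabla)
  (f_smooth : smooth_function f) (f_pos : forall x : M, 0 < f x)
  (sas : rescaled_sasaki g nabla f Sgf).

Local Notation im i := (mcoord M i @` mdom M i).

(** Splitting u and v into horizontal and vertical parts reduces the metric to the
values that define it. *)
Lemma sasaki_formula i (y : 'rV[R]_(n + N)) u v : im i (lsubmx y) ->
  bform (Sgf i y) u v = f (mpar M i (lsubmx y)) * bform (g i (lsubmx y)) (lsubmx u) (lsubmx v)
    + tensor_inner (g i (lsubmx y)) (vertical_part (nabla i (lsubmx y)) (fibre y) u)
       (vertical_part (nabla i (lsubmx y)) (fibre y) v).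
Proof.
move=> [x ix xy]; have [] := sas (fibre y) ix; rewrite xy fibreK => sG vv vh hh.
rewrite {1}(hlift_vertical_part (nabla i (lsubmx y)) (fibre y) u) {1}(hlift_vertical_part (nabla i (lsubmx y)) (fibre y) v).
rewrite bformDl !bformDr hh vv vh (bformC _ _ sG) vh addr0 add0r.
by rewrite -xy m_coordK.
Qed.

Lemma near_im i (y : 'rV[R]_(n + N)) : im i (lsubmx y) -> \forall z \near y, im i (lsubmx z).
Proof.
move=> iy; have cl : {for y, continuous (lsubmx : 'rV[R]_(n + N) -> 'rV[R]_n)}.
  by apply: differentiable_continuous; exact: differentiable_lsubmx.
by apply: (cl); apply: open_nbhs_nbhs; split=> //; exact: m_image_open.
Qed.

Lemma fibre_hlift Gam (t : tidx n p q -> R) X k : fibre (hlift Gam t X) k =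
  \sum_s X 0 s *
      (\sum_(mu < q) \sum_m Gam m s (k.2 mu) * t (k.1, upd k.2 mu m)
       - \sum_(la < p) \sum_m Gam (k.1 la) s m * t (upd k.1 la m, k.2)).
Proof. by rewrite /hlift fibre_row_mx. Qed.

Lemma differentiable_fibre k y : differentiable (fun z : 'rV[R]_(n + N) => fibre z k) y.
Proof.
rewrite (_ : (fun z => _) = (fun z : 'rV[R]_(n + N) => z 0 (rshift n (enum_rank k)))).
  exact: differentiable_coord.
by apply/funext => z; rewrite /fibre mxE.
Qed.

Lemma differentiable_vertical_part i (y v : 'rV[R]_(n + N)) k : im i (lsubmx y) ->
  differentiable (fun z => vertical_part (nabla i (lsubmx z)) (fibre z) v k) y.
Proof.
move=> iy; rewrite /vertical_part; apply: differentiable_add; first exact: differentiable_cst.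
apply: differentiable_opp.
have dN h a b : differentiable (fun z : 'rV[R]_(n + N) => nabla i (lsubmx z) h a b) y.
  apply: (@differentiable_base _ _ _ (fun w => nabla i w h a b)).
  apply: smooth_on_differentiable iy; first exact: m_image_open.
  exact (smooth_christoffel i h a b gR lc).
rewrite (_ : (fun z => _) = fun z => \sum_s lsubmx v 0 s *
      (\sum_(mu < q) \sum_m nabla i (lsubmx z) m s (k.2 mu) * fibre z (k.1, upd k.2 mu m)
       - \sum_(la < p) \sum_m nabla i (lsubmx z) (k.1 la) s m * fibre z (upd k.1 la m, k.2))); last first.
  by apply/funext => z; rewrite fibre_hlift.
apply: differentiable_bsum => s; apply: differentiable_mul; first exact: differentiable_cst.
apply: differentiable_add; [|apply: differentiable_opp]; apply: differentiable_bsum => mu;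
  apply: differentiable_bsum => m; apply: differentiable_mul => //; exact: differentiable_fibre.
Qed.

Let gsmooth i a b : smooth_on (im i) (fun w => g i w a b).
Proof. by have [gs _ _ _] := gR; exact: gs. Qed.

Let im_open i : open (im i). Proof. exact: m_image_open. Qed.

Local Notation phi i := (f \o mpar M i).

Let phi_smooth i : smooth_on (im i) (phi i). Proof. exact: f_smooth. Qed.

Definition inner_coef (h : 'M[R]_n) (k c : tidx n p q) : R :=
  (\prod_(l < p) h (k.1 l) (c.1 l)) * (\prod_(m < q) (invmx h) (k.2 m) (c.2 m)).

Lemma differentiable_inner_coef i (y : 'rV[R]_(n + N)) k c : im i (lsubmx y) ->
  differentiable (fun z : 'rV[R]_(n + N) => inner_coef (g i (lsubmx z)) k c) y.
Proof.
move=> iy; apply: differentiable_mul; apply: differentiable_bprod => l.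
  apply: (@differentiable_base _ _ _ (fun w => g i w _ _)).
  exact (smooth_on_differentiable (@im_open i) (@gsmooth i _ _) iy).
apply: (@differentiable_base _ _ _ (fun w => invmx (g i w) _ _)).
have sI a b : smooth_on (im i) (fun w => invmx (g i w) a b).
  apply: smooth_on_invmx => //.
  by move=> w [x ix <-]; exact: riemannian_metric_unit.
exact (smooth_on_differentiable (@im_open i) (@sI _ _) iy).
Qed.

(** The metric is prescribed by its values, with no regularity assumed; its
components are differentiable because they are given by the formula above. *)
Lemma differentiable_sasaki i (y : 'rV[R]_(n + N)) a b : im i (lsubmx y) ->
  differentiable (fun z => Sgf i z a b) y.
Proof.
move=> iy; pose A c z := vertical_part (nabla i (lsubmx z)) (fibre z) ('e_c : 'rV[R]_(n + N)).
pose F z := phi i (lsubmx z) * (\sum_c \sum_d lsubmx ('e_a : 'rV[R]_(n + N)) 0 c *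
   g i (lsubmx z) c d * lsubmx ('e_b : 'rV[R]_(n + N)) 0 d) +
   \sum_k \sum_c inner_coef (g i (lsubmx z)) k c * A a z k * A b z c.
have FE : \forall z \near y, F z = Sgf i z a b.
  apply: filterS (near_im iy) => z iz.
  by rewrite -bform_delta sasaki_formula // bformE.
apply: near_eq_differentiable FE _; apply: differentiable_add.
  apply: differentiable_mul.
    apply: (@differentiable_base _ _ _ (phi i)).
    exact (smooth_on_differentiable (@im_open i) (@phi_smooth i) iy).
  apply: differentiable_bsum => c; apply: differentiable_bsum => d.
  apply: differentiable_mul; last exact: differentiable_cst.
  apply: differentiable_mul; first exact: differentiable_cst.
  apply: (@differentiable_base _ _ _ (fun w => g i w c d)).
  exact (smooth_on_differentiable (@im_open i) (@gsmooth i _ _) iy).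
apply: differentiable_bsum => k; apply: differentiable_bsum => c.
apply: differentiable_mul; last exact: differentiable_vertical_part.
apply: differentiable_mul; last exact: differentiable_vertical_part.
exact: differentiable_inner_coef.
Qed.

(** Where the vertical part of v vanishes, the fibre term of the energy, being
quadratic in this part, has zero derivative. *)
Lemma is_derive_kinetic_sasaki i (y v : 'rV[R]_(n + N)) c (df : R) : im i (lsubmx y) ->
  (forall k, vertical_part (nabla i (lsubmx y)) (fibre y) v k = 0) ->
  is_derive (lsubmx y) (lsubmx ('e_c : 'rV[R]_(n + N)))
     (fun w => phi i w * kinetic (g i) (lsubmx v) w) df ->
  is_derive y 'e_c (kinetic (Sgf i) v) df.
Proof.
move=> iy Ay dK; pose A z := vertical_part (nabla i (lsubmx z)) (fibre z) v.
have KE : \forall z \near y, phi i (lsubmx z) * kinetic (g i) (lsubmx v) (lsubmx z) +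
    (\sum_k \sum_c inner_coef (g i (lsubmx z)) k c * A z k * A z c) * 2^-1 = kinetic (Sgf i) v z.
  apply: filterS (near_im iy) => z iz.
  by rewrite /kinetic sasaki_formula // mulrDr mulrCA [2^-1 * tensor_inner _ _ _]mulrC.
apply: near_eq_is_derive KE _.
have dS : is_derive y ('e_c : 'rV[R]_(n + N))
    (fun z => \sum_k \sum_c inner_coef (g i (lsubmx z)) k c * A z k * A z c)
    (\sum_(k : tidx n p q) \sum_(c : tidx n p q) 0).
  apply: is_derive_bsum => k; apply: is_derive_bsum => c'.
  have dA k' : is_derive y 'e_c (fun z => A z k') ('D_('e_c) (fun z => A z k') y).
    by apply: derivableP; apply: diff_derivable; exact: differentiable_vertical_part.
  have dP : is_derive y ('e_c : 'rV[R]_(n + N)) (fun z : 'rV[R]_(n + N) => inner_coef (g i (lsubmx z)) k c')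
      ('D_('e_c) (fun z : 'rV[R]_(n + N) => inner_coef (g i (lsubmx z)) k c') y).
    by apply: derivableP; apply: diff_derivable; exact: differentiable_inner_coef.
  have A0 k' : A y k' = 0 by exact: Ay.
  have := is_derive_mul (is_derive_mul dP (dA k)) (dA c').
  by rewrite !A0 !mulr0 !mul0r addr0.
have S0 : \sum_(k : tidx n p q) \sum_(c : tidx n p q) (0 : R) = 0.
  by rewrite big1 // => k _; rewrite big1.
rewrite S0 in dS.
have := is_deriveD (is_derive_base dK) (is_derive_mul dS (is_derive_cst (2^-1 : R) y ('e_c : 'rV[R]_(n + N)))).
by rewrite mul0r mulr0 !addr0.
Qed.

End Sasaki.

(** * Horizontal lifts of geodesics *)

Section LiftedGeodesics.
Variables (R : realType) (n p q : nat) (M : manifold R n)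
    (g : bilinear_field (charts M)) (nabla : connection (charts M))
    (f : M -> R) (Sgf : bilinear_field (tensor_bundle M p q))
    (nablahat : connection (tensor_bundle M p q)).
Hypotheses (gR : riemannian_metric g) (lc : levi_civita g nabla)
  (f_smooth : smooth_function f) (f_pos : forall x : M, 0 < f x)
  (sas : rescaled_sasaki g nabla f Sgf) (lch : levi_civita Sgf nablahat).

Local Notation N := #|tidx n p q|.
Local Notation im i := (mcoord M i @` mdom M i).
Local Notation phi i := (f \o mpar M i).

Lemma sasaki_sym i (y : 'rV[R]_(n + N)) : im i (lsubmx y) -> (Sgf i y)^T = Sgf i y.
Proof. by move=> [x ix xy]; have [] := sas (fibre y) ix; rewrite xy fibreK. Qed.

(** The base component w1 and the vertical part wA of the vector w represented by
E are detected by testing w against horizontal and vertical vectors respectively. *)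
Lemma sasaki_nondegenerate i (y : 'rV[R]_(n + N)) (E : 'I_(n + N) -> R) : im i (lsubmx y) ->
  (forall c, \sum_l Sgf i y c l * E l = 0) -> forall l, E l = 0.
Proof.
move=> iy SE; pose w := \row_l E l.
have bw u : bform (Sgf i y) u w = 0.
  rewrite bformE big1 // => a _.
  under eq_bigr => b _ do rewrite mxE -mulrA.
  by rewrite -mulr_sumr SE mulr0.
have [x ix xy] := iy; have [_ _ gpos _] := gR.
have t0 (A B : tidx n p q -> R) h : (forall k, A k = 0) -> tensor_inner h A B = 0.
  move=> A0; rewrite /tensor_inner big1 // => k _; rewrite big1 // => c _.
  by rewrite A0 mulr0 mul0r.
have vh X k : vertical_part (nabla i (lsubmx y)) (fibre y) (hlift (nabla i (lsubmx y)) (fibre y) X) k = 0.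
  by rewrite /vertical_part /hlift row_mxKl subrr.
have w1 : lsubmx w = 0.
  apply/eqP; apply: contraT => /(gpos i x ix).
  have := bw (hlift (nabla i (lsubmx y)) (fibre y) (lsubmx w)).
  rewrite (sasaki_formula sas) // t0 // addr0 {1}/hlift row_mxKl => /eqP.
  rewrite mulf_eq0 gt_eqF //= => /eqP E0.
  by rewrite xy E0 ltxx.
have wA k : vertical_part (nabla i (lsubmx y)) (fibre y) w k = 0.
  apply: (@tensor_inner_nondegenerate _ _ _ _ (g i (lsubmx y))).
    by rewrite -xy; exact: riemannian_metric_unit.
  move=> B; have := bw (vlift B).
  rewrite (sasaki_formula sas) // {1}/vlift row_mxKl {1}/bform !mul0mx mxE mulr0 add0r.
  rewrite (_ : vertical_part _ _ (vlift B) = B) //; apply/funext => c.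
  rewrite /vertical_part {1}/vlift fibre_row_mx /vlift row_mxKl fibre_hlift.
  by rewrite big1 ?subr0 // => s _; rewrite mxE mul0r.
move=> l; have : w = 0; last by move=> /rowP/(_ l); rewrite !mxE.
rewrite (hlift_vertical_part (nabla i (lsubmx y)) (fibre y) w) w1.
rewrite (_ : vertical_part _ _ _ = fun=> 0); last exact/funext.
rewrite /hlift /vlift add_row_mx addr0.
apply/rowP => c; case: (split_ordP c) => k ->; rewrite ?row_mxEl ?row_mxEr !mxE //.
by rewrite addr0 big1 // => s _; rewrite mxE mul0r.
Qed.

(** The coordinates x of a geodesic and y of its horizontal lift, near a parameter t
at which the curve is in the domain of chart i. *)
Section Curve.
Variables (J : set R) (gam : R -> M) (S : forall t : R, tensor p q (gam t)) (i : mchart M) (t : R).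
Hypotheses (oJ : open J) (geo : @geodesic R n (charts M) nabla J gam)
  (hor : horizontal_lift nabla J S) (Jt : J t) (it : mdom M i (gam t)).

Let x s := mcoord M i (gam s).
Let y s : 'rV[R]_(n + N) := chart_coord (tensor_bundle M p q) i (lift_curve S s).

Let yl s : lsubmx (y s) = x s. Proof. exact: row_mxKl. Qed.
Let yf s : fibre (y s) = tcomp (S s) i.
Proof. by apply/funext => k; exact: fibre_row_mx. Qed.

Let near_t : \forall s \near t, J s /\ mdom M i (gam s).
Proof.
by have [sm _] := geo; have [ni _] := sm t Jt i it; apply: near_and => //; exact: open_nbhs_nbhs.
Qed.

Let imx s : mdom M i (gam s) -> im i (x s). Proof. by move=> ?; exists (gam s). Qed.

Let dx s a k : J s -> mdom M i (gam s) -> derivable (derive1n k (fun r => x r 0 a)) s 1.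
Proof. by move=> Js js; have [sm _] := geo; have [_ /(_ a k)] := sm s Js i js. Qed.

Let dy s a k : J s -> mdom M i (gam s) -> derivable (derive1n k (fun r => y r 0 a)) s 1.
Proof. by move=> Js js; have [sm _] := hor; have [_ /(_ a k)] := sm s Js i js. Qed.

Let vel_l s : lsubmx (vel y s) = vel x s.
Proof.
apply/rowP => a; rewrite !mxE; congr (derive1 _ s).
by apply/funext => r; rewrite [LHS]row_mxEl.
Qed.

Let vel_r s k : fibre (vel y s) k = derive1 (fun r => tcomp (S r) i k) s.
Proof.
rewrite /fibre !mxE; congr (derive1 _ s); apply/funext => r.
by rewrite [LHS]row_mxEr mxE enum_rankK.
Qed.

Let vertical_part_vel s k : J s -> mdom M i (gam s) -> vertical_part (nabla i (x s)) (fibre (y s)) (vel y s) k = 0.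
Proof.
move=> Js js; have [_ par] := hor; have /= E := par s Js i js k.
rewrite /vertical_part vel_r vel_l fibre_hlift; apply: etrans _ E.
rewrite -sumrN yf; congr (_ + _); apply: eq_bigr => a _.
by rewrite -mulrN opprB mxE.
Qed.

Let vertical_part_vel_t k : vertical_part (nabla i (lsubmx (y t))) (fibre (y t)) (vel y t) k = 0.
Proof. by rewrite yl; exact: vertical_part_vel. Qed.

Let momentum_lift s c : J s -> mdom M i (gam s) ->
  f (gam s) * bform (g i (x s)) (lsubmx ('e_c : 'rV[R]_(n + N))) (vel x s) = momentum (Sgf i) y c s.
Proof.
move=> Js js; rewrite /momentum -bform_deltal (sasaki_formula sas); last by rewrite yl; exact: imx.
rewrite yl vel_l m_coordK // /tensor_inner [X in _ = _ + X]big1 ?addr0 // => k _.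
by rewrite big1 // => c' _; rewrite vertical_part_vel // mulr0.
Qed.

(** Near t the lift has no momentum along the fibre, its velocity being horizontal,
and a displacement along the fibre does not change f g. *)
Lemma euler_lagrange_lift_r k : euler_lagrange (Sgf i) y t (rshift n k) = 0.
Proof.
have it' : im i (lsubmx (y t)) by rewrite yl; exact: imx.
have M0 : {near t, (fun=> 0) =1 momentum (Sgf i) y (rshift n k)}.
  apply: filterS near_t => s [Js js]; rewrite -momentum_lift // lsubmx_delta_r.
  by rewrite /bform !mul0mx mxE mulr0.
have D0 : is_derive (lsubmx (y t)) (lsubmx ('e_(rshift n k) : 'rV[R]_(n + N)))
    (fun w => phi i w * kinetic (g i) (lsubmx (vel y t)) w) 0.
  by rewrite lsubmx_delta_r; exact: is_derive0.
have [_ EK] := is_derive_kinetic_sasaki gR lc sas it' vertical_part_vel_t D0.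
have M1 := near_eq_derive (1 : R) M0; rewrite derive_cst in M1.
by rewrite /euler_lagrange derive1E -M1 sub0r; apply: (canLR opprK); rewrite oppr0.
Qed.

(** In the directions of M the equations are those of the metric f g. By Leibniz'
rule they differ from f times those of g, which vanish, by the terms in which f
is differentiated. *)
Lemma euler_lagrange_lift_l a : euler_lagrange (Sgf i) y t (lshift N a) =
  (\sum_b vel x t 0 b * partial (phi i) b (x t)) * momentum (g i) x a t
  - partial (phi i) a (x t) * kinetic (g i) (vel x t) (x t).
Proof.
have ix := imx it; have it' : im i (lsubmx (y t)) by rewrite yl.
have oim : open (im i) by exact: m_image_open.
have [gs gsym _ _] := gR.
have dxt b : derivable (fun s => x s 0 b) t 1 by exact: (@dx t b 0).
have dvt b : derivable (fun s => vel x s 0 b) t 1 by rewrite velE; exact: (@dx t b 1).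
have dg b c : differentiable (fun w => g i w b c) (x t).
  exact (smooth_on_differentiable oim (gs i b c) ix).
have dphi : differentiable (phi i) (x t).
  exact (smooth_on_differentiable oim (f_smooth i) ix).
have ELg : euler_lagrange (g i) x t a = 0.
  apply: (geodesic_equationP gR lc ix dxt dvt).1 => h.
  have [_ eqg] := geo; have := eqg t Jt i it h.
  rewrite velE => E; rewrite -[RHS]E.
  by congr (_ + _); apply: eq_bigr => b _; apply: eq_bigr => c _; rewrite !mxE.
have ME : {near t, (fun s => phi i (x s) * momentum (g i) x a s) =1
    momentum (Sgf i) y (lshift N a)}.
  apply: filterS near_t => s [Js js]; rewrite -momentum_lift // lsubmx_delta_l.
  by rewrite bform_deltal /= m_coordK.
have dphix : is_derive t 1 (fun s => phi i (x s)) (\sum_b vel x t 0 b * partial (phi i) b (x t)).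
  by apply: (@is_derive_curve _ _ (phi i)) => // b; rewrite mxE derive1E; exact: derivableP.
have dmom : is_derive t 1 (momentum (g i) x a) (derive1 (momentum (g i) x a) t).
  by rewrite derive1E; apply: derivableP; have [] := is_derive_momentum a dxt dvt dg.
have dkin : is_derive (x t) 'e_a (kinetic (g i) (vel x t)) (partial (kinetic (g i) (vel x t)) a (x t)).
  have [|dk _] := @is_derive_kinetic _ _ (g i) (vel x t) a (x t).
    by move=> b c; exact: diff_derivable.
  exact: derivableP.
have dphia : is_derive (x t) 'e_a (phi i) (partial (phi i) a (x t)).
  by apply: derivableP; exact: diff_derivable.
have [_ EM] := near_eq_is_derive ME (is_derive_mul dphix dmom).
have DK : is_derive (lsubmx (y t)) (lsubmx ('e_(lshift N a) : 'rV[R]_(n + N)))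
    (fun w => phi i w * kinetic (g i) (lsubmx (vel y t)) w)
    (partial (phi i) a (x t) * kinetic (g i) (vel x t) (x t) +
     phi i (x t) * partial (kinetic (g i) (vel x t)) a (x t)).
  by rewrite lsubmx_delta_l yl vel_l; exact: is_derive_mul.
have [_ EK] := is_derive_kinetic_sasaki gR lc sas it' vertical_part_vel_t DK.
rewrite /euler_lagrange derive1E EM; apply: etrans (congr1 (fun r => _ - r) EK) _.
rewrite opprD addrACA -mulrBr -/(euler_lagrange (g i) x t a) ELg mulr0 addr0 //.
Qed.

(** Vanishing of the geodesic equation of the bundle is vanishing of the
Euler-Lagrange covector of the lift, as the Sasaki metric is nondegenerate. *)
Lemma lift_geodesic_eqP :
  (forall h, derive1n 2 (@curve_coord R _ (tensor_bundle M p q) (lift_curve S) i h) t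
    + \sum_a \sum_b nablahat i (y t) h a b
                    * derive1 (@curve_coord R _ (tensor_bundle M p q) (lift_curve S) i a) t
                    * derive1 (@curve_coord R _ (tensor_bundle M p q) (lift_curve S) i b) t = 0)
  <-> forall a, (\sum_b vel x t 0 b * partial (phi i) b (x t)) * momentum (g i) x a t
    = partial (phi i) a (x t) * kinetic (g i) (vel x t) (x t).
Proof.
have ix := imx it; have it' : im i (lsubmx (y t)) by rewrite yl.
have imy : (chart_coord (tensor_bundle M p q) i @` chart_dom (tensor_bundle M p q) i) (y t).
  by exists (lift_curve S t).
have [sG cG] := lch imy.
pose E h := derive1 (fun s => vel y s 0 h) t
   + \sum_a \sum_b nablahat i (y t) h a b * vel y t 0 a * vel y t 0 b.
have EE h : derive1n 2 (@curve_coord R _ (tensor_bundle M p q) (lift_curve S) i h) t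
    + \sum_a \sum_b nablahat i (y t) h a b
                    * derive1 (@curve_coord R _ (tensor_bundle M p q) (lift_curve S) i a) t
                    * derive1 (@curve_coord R _ (tensor_bundle M p q) (lift_curve S) i b) t = E h.
  rewrite /E velE; congr (_ + _).
  by apply: eq_bigr => a _; apply: eq_bigr => b _; rewrite !mxE.
have EL c : euler_lagrange (Sgf i) y t c = \sum_l Sgf i (y t) c l * E l.
  apply: euler_lagrange_christoffel => //.
  - by move=> a; exact: (@dy t a 0).
  - by move=> a; rewrite velE; exact: (@dy t a 1).
  - by move=> a b; exact: (differentiable_sasaki gR lc f_smooth sas).
  - exact: sasaki_sym.
split=> [E0 a|H h].
  apply/eqP; rewrite -subr_eq0 -euler_lagrange_lift_l EL; apply/eqP.
  by rewrite big1 // => l _; rewrite -EE E0 mulr0.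
rewrite EE; apply: sasaki_nondegenerate it' _ h => c; rewrite -EL.
case: (split_ordP c) => k ->.
  by rewrite euler_lagrange_lift_l H subrr.
exact: euler_lagrange_lift_r.
Qed.

End Curve.

End LiftedGeodesics.

(** * The zero section and functions with zero differential *)

Section ZeroSection.
Variables (R : realType) (n p q : nat) (M : manifold R n).

Lemma zero_tensor_transform (x : M) i j : mdom M i x -> mdom M j x -> forall k : tidx n p q,
  0 = \sum_(c : tidx n p q) (\prod_(l < p) jac i j x (k.1 l) (c.1 l)) *
      (\prod_(m < q) jac j i x (c.2 m) (k.2 m)) * 0 :> R.
Proof. by move=> _ _ k; rewrite big1 // => c _; rewrite mulr0. Qed.

Definition zero_tensor (x : M) : tensor p q x :=
  @Tensor R n M p q x (fun _ _ => 0) (fun _ _ _ => erefl) (@zero_tensor_transform x).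

Lemma derive1n_cst0 k : derive1n k (cst 0 : R -> R) = cst 0.
Proof.
elim: k => [//|k IH]; rewrite derive1nS IH; apply/funext => t.
exact: derive1_cst.
Qed.

Lemma zero_horizontal_lift (nabla : connection (charts M)) (J : set R) (gam : R -> M) :
  @geodesic R n (charts M) nabla J gam ->
  horizontal_lift nabla J (fun t => zero_tensor (gam t)).
Proof.
move=> [sm _]; split=> [t Jt i it|t Jt i it k] /=.
  have [ni di] := sm t Jt i it; split=> // a k.
  case: (split_ordP a) => b ->.
    rewrite (_ : curve_coord _ _ _ = @curve_coord R n (charts M) gam i b) //.
    by apply/funext => s; rewrite /curve_coord /= row_mxEl.
  rewrite (_ : curve_coord _ _ _ = cst 0) ?derive1n_cst0; first exact: derivable_cst.
  by apply/funext => s; rewrite /curve_coord /= row_mxEr mxE.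
rewrite derive1_cst add0r big1 // => s _.
rewrite !big1 ?subrr ?mulr0 // => l _; rewrite big1 // => m _; exact: mulr0.
Qed.

End ZeroSection.

(** The level sets of f are open by the mean value theorem, hence also closed, and M
is connected. *)
Lemma constant_of_partial0 (R : realType) (n : nat) (M : manifold R n) (f : M -> R) :
  smooth_function f ->
  (forall i x a, mdom M i x -> partial (f \o mpar M i) a (mcoord M i x) = 0) ->
  exists C, forall x, f x = C.
Proof.
move=> sf df.
have loc x : \forall z \near x, f z = f x.
  have [i ix] := m_cover x; set U := mcoord M i @` mdom M i.
  have Ux : U (mcoord M i x) by exists x.
  have /nbhs_ballP[r /= r0 rU] : nbhs (mcoord M i x) U.
    by apply: open_nbhs_nbhs; split=> //; exact: m_image_open.
  have ci : {for x, continuous (mcoord M i)} by apply: m_coord_cont; rewrite inE.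
  have n1 : \forall z \near x, ball (mcoord M i x) r (mcoord M i z).
    by apply: (ci); exact: nbhsx_ballx.
  have n2 : \forall z \near x, mdom M i z.
    by apply: open_nbhs_nbhs; split=> //; exact: m_dom_open.
  apply: filterS (near_and n1 n2) => z [bz iz].
  have [|xi xib E] := @mean_value_coords _ _ (f \o mpar M i) _ _ _ r _ (ballxx _ r0) bz.
    by move=> y /rU Uy a; exact: smooth_on_derivable (sf i) Uy.
  apply/eqP; rewrite -subr_eq0; apply/eqP; move: E; rewrite /= !m_coordK // => ->.
  rewrite big1 // => a _; have [w iw <-] := rU _ (xib a).
  by rewrite df // mulr0.
case: (pselect (exists x : M, True)) => [[x0 _]|nx]; last first.
  by exists 0 => x; case: nx; exists x.
exists (f x0) => x; pose B := [set z : M | f z = f x0].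
have oB : open B by rewrite openE => z Bz; apply: filterS (loc z) => w wz; exact: etrans wz Bz.
have cB : closed B.
  rewrite -[B]setCK; apply: open_closedC; rewrite openE => z Bz.
  by apply: filterS (loc z) => w wz Bw; apply: Bz; exact: etrans (esym wz) Bw.
have : B = [set: M].
  apply: (m_connected (m := M)); first by exists x0.
  - by exists B => //; rewrite setTI.
  - by exists B => //; rewrite setTI.
by move=> BT; have : [set: M] x by []; rewrite -BT.
Qed.

Theorem theorem13 (R : realType) (n p q : nat) (M : manifold R n)
    (g : bilinear_field (charts M)) (nabla : connection (charts M))
    (f : M -> R)
    (Sgf : bilinear_field (tensor_bundle M p q))
    (nablahat : connection (tensor_bundle M p q))
    (g_riem : riemannian_metric g) (nabla_lc : levi_civita g nabla)
    (f_smooth : smooth_function f) (f_pos : forall x : M, 0 < f x)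
    (Sgf_sasaki : rescaled_sasaki g nabla f Sgf)
    (nablahat_lc : levi_civita Sgf nablahat) :
  (forall (J : set R) (gam : R -> M) (S : forall t : R, tensor p q (gam t)),
     open J -> is_interval J ->
     @geodesic R n (charts M) nabla J gam ->
     horizontal_lift nabla J S ->
     geodesic nablahat J (lift_curve S))
  <-> exists C : R, forall x : M, f x = C.
Proof.
split=> [H|[C fC] J gam S oJ _ geo hor]; last first.
  split=> [|t Jt i it]; first by have [] := hor.
  apply: (lift_geodesic_eqP g_riem nabla_lc f_smooth f_pos Sgf_sasaki nablahat_lc oJ geo hor Jt it).2.
  have p0 a w : partial (f \o mpar M i) a w = 0.
    rewrite (_ : _ \o _ = cst C); first exact: derive_cst.
    by apply/funext => z; exact: fC.
  by move=> a; rewrite big1 ?p0 ?mul0r // => b _; rewrite p0 mulr0.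
apply: constant_of_partial0 => // i x a ix.
(* The geodesic starting from x in the direction of the a-th coordinate, and the
zero tensor along it. *)
have [T T0 [gam [geo gam0 velx]]] := geodesic_exists g_riem nabla_lc 'e_a ix.
have oJ : open `]- T, T[%classic by exact: itv_open.
have J0 : `]- T, T[%classic (0 : R) by rewrite /= in_itv /= oppr_lt0 T0.
have hor := @zero_horizontal_lift _ _ p q _ _ _ _ geo.
have [_ lgeo] := H _ gam _ oJ (@interval_is_interval _ _) geo hor.
have i0 : mdom M i (gam 0) by rewrite gam0.
have := (lift_geodesic_eqP g_riem nabla_lc f_smooth f_pos Sgf_sasaki nablahat_lc oJ geo hor J0 i0).1 (lgeo 0 J0 i i0).
rewrite gam0.
set X := fun s => mcoord M i (gam s).
have vE : vel X 0 = 'e_a by apply/rowP => b; rewrite mxE velx.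
have mE b : momentum (g i) X b 0 = g i (mcoord M i x) b a.
  rewrite /momentum vE {1}/X gam0 (bigD1 a) //= mxE !eqxx mulr1 big1 ?addr0 // => c ca.
  by rewrite mxE (negPf ca) andbF mulr0.
rewrite vE => /(_ a); rewrite mE /kinetic bform_delta.
rewrite (bigD1 a) //= mxE !eqxx mul1r big1 ?addr0; last first.
  by move=> c ca; rewrite mxE (negPf ca) andbF mul0r.
have gaa : 0 < g i (mcoord M i x) a a.
  have [_ _ gpos _] := g_riem; rewrite -bform_delta; apply: gpos => //.
  by apply/eqP => /rowP/(_ a); rewrite !mxE !eqxx => /eqP; rewrite oner_eq0.
move: gaa (partial _ _ _) => /lt0r_neq0 + D.
move: (g i (mcoord M i x) a a) => r r0 DE.
(* DE reads D r = D r / 2, where r = |e_a|^2 and D is the a-th partial derivative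
of f at x. *)
have : D * r = 0 by lra.
by move=> /eqP; rewrite mulf_eq0 (negPf r0) orbF => /eqP.
Qed.
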